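(* Let $R$ be an associative unital right noetherian ring, let $n\geq 0$ be an integer, and let $\mathcal{I}_n$ be the class of all right $R$-modules of injective dimension $\leq n$. Let $\mathcal{M}$ be either the class of all embeddings, the class of all RD-embeddings, or the class of all pure embeddings of right $R$-modules. Then $(\mathcal{I}_n,\leq_{\mathcal{M}})$ is stable.
   Context: Modules are right $R$-modules; $\|M\|$ denotes the cardinality of a module $M$. An embedding is a monomorphism. A submodule $N$ of $M$ is an RD-submodule if $N\cap Mr=Nr$ for all $r\in R$; it is a pure submodule if every finite system of $R$-linear equations with right-hand side in $N$ that is solvable in $M$ is solvable in $N$. An RD-embedding (pure embedding) is a monomorphism whose image is an RD-submodule (pure submodule) of its codomain. Let $\mathcal{A}$ be a class of modules closed under isomorphism. For $A,B\in\mathcal{A}$, $A\leq_{\mathcal{M}}B$ means that $A$ is a submodule of $B$ and the inclusion is in $\mathcal{M}$. Write $\mathbf{A}=(\mathcal{A},\leq_{\mathcal{M}})$. An $\mathbf{A}$-embedding is a monomorphism $f:A\to B$ with $A,B\in\mathcal{A}$ and $f(A)\leq_{\mathcal{M}}B$. $\operatorname{LS}(\mathbf{A})$ is the least infinite cardinal $\lambda\geq\operatorname{card}(R)$ such that whenever $A$ is a submodule of $B\in\mathcal{A}$ there is $A'\in\mathcal{A}$ with $A\subseteq A'\leq_{\mathcal{M}}B$ and $\|A'\|\leq\|A\|+\lambda$. Galois types: consider triples $(\bar b,A,N)$ with $N\in\mathcal{A}$, $A$ a submodule of $N$, and $\bar b$ a (possibly infinite) tuple of elements of $N$. Triples $(\bar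 b_1,A_1,N_1),(\bar b_2,A_2,N_2)$ are atomically related if $A_1=A_2=:A$ and there are $N\in\mathcal{A}$ and $\mathbf{A}$-embeddings $f_i:N_i\to N$ ($i=1,2$) restricting to the identity on $A$ with $f_1(\bar b_1)=f_2(\bar b_2)$. Let $E^{\mathbf{A}}$ be the transitive closure of this relation; $\mathbf{gtp}_{\mathbf{A}}(\bar b/A;N)$ is the $E^{\mathbf{A}}$-class of $(\bar b,A,N)$. For $M\in\mathcal{A}$, $\mathbf{gS}_{\mathbf{A}}(M)=\{\mathbf{gtp}_{\mathbf{A}}(b/M;N)\mid M\leq_{\mathcal{M}}N\in\mathcal{A},\ b\in N\text{ a single element}\}$. $\mathbf{A}$ is stable in $\lambda$ if $|\mathbf{gS}_{\mathbf{A}}(M)|\leq\lambda$ for every $M\in\mathcal{A}$ with $\|M\|=\lambda$; $\mathbf{A}$ is stable if it is stable in $\lambda$ for some cardinal $\lambda\geq\operatorname{LS}(\mathbf{A})$. *)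

(* Defs.v *)
From Stdlib Require Relation_Operators.
From mathcomp Require Import all_boot all_algebra.
From mathcomp Require Import boolp classical_sets functions cardinality.

Set Implicit Arguments.
Unset Strict Implicit.
Unset Printing Implicit Defensive.

Import GRing.Theory.
Local Open Scope ring_scope.
Local Open Scope classical_set_scope.
Local Open Scope card_scope.

(* A right R-module is a left module over the converse ring: m r is written
   [r *: m] with [r : R^c].  [pzRingType] allows the zero ring. *)
Notation rmodType R := (lmodType (R^c)).

(* Cardinals are represented by types living in the same universe as the
   carriers of modules.  With an unconstrained [Type], a quantified cardinal
   could be larger than every module, which would make stability vacuous. *)
Definition cardinal := Type@{GRing.Lmodule.axioms_.u0}.

Definition right_ideal (R : pzRingType) (I : set R) : Prop :=
  [/\ I 0,
      forall x y, I x -> I y -> I (x - y) &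
      forall x r, I x -> I (x * r)].

Definition right_noetherian (R : pzRingType) : Prop :=
  forall I : nat -> set R,
    (forall k, right_ideal (I k)) ->
    (forall k, I k `<=` I k.+1) ->
    exists k, forall l, (k <= l)%N -> I l = I k.

Definition injective_module (R : pzRingType) (E : rmodType R) : Prop :=
  forall (A B : rmodType R) (i : {linear A -> B}) (f : {linear A -> E}),
    injective i -> exists g : {linear B -> E}, forall a, g (i a) = f a.

(* An exact sequence 0 -> M -> E 0 -> E 1 -> ... with every E i injective and
   E i = 0 for i > n. *)
Definition injdim_le (R : pzRingType) (n : nat) (M : rmodType R) : Prop :=
  exists (E : nat -> rmodType R) (eta : {linear M -> E 0%N})
         (d : forall i, {linear E i -> E i.+1}),
    [/\ forall i, injective_module (E i),
        injective eta,
        range eta = [set x | d 0%N x = 0],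
        forall i, range (d i) = [set x | d i.+1 x = 0] &
        forall i, (n < i)%N -> forall x : E i, x = 0].

Definition RD_submodule (R : pzRingType) (M : rmodType R) (N : set M) : Prop :=
  forall r : R^c, N `&` range (fun m : M => r *: m) = [set r *: m | m in N].

Definition pure_submodule (R : pzRingType) (M : rmodType R) (N : set M) : Prop :=
  forall (p q : nat) (r : 'I_p -> 'I_q -> R^c) (b : 'I_p -> M),
    (forall i, N (b i)) ->
    (exists x : 'I_q -> M, forall i, \sum_j r i j *: x j = b i) ->
    exists x : 'I_q -> M,
      (forall j, N (x j)) /\ (forall i, \sum_j r i j *: x j = b i).

Definition module_class (R : pzRingType) := rmodType R -> Prop.

Definition morphism_class (R : pzRingType) :=
  forall A B : rmodType R, {linear A -> B} -> Prop.

Definition embeddings (R : pzRingType) : morphism_class R :=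
  fun A B f => injective f.

Definition RD_embeddings (R : pzRingType) : morphism_class R :=
  fun A B f => injective f /\ RD_submodule (range f).

Definition pure_embeddings (R : pzRingType) : morphism_class R :=
  fun A B f => injective f /\ pure_submodule (range f).

Section AbstractClass.
Variables (R : pzRingType) (C : module_class R) (M : morphism_class R).

(* Submodules are represented by injective linear maps, so this also renders
   "A <=_M B", the map f playing the role of the inclusion.  It agrees with
   "f(A) <=_M B" for C and M invariant under isomorphism. *)
Definition A_embedding (A B : rmodType R) (f : {linear A -> B}) : Prop :=
  [/\ C A, C B, injective f & M f].

Definition LS_bound (L : cardinal) : Prop :=
  [/\ infinite_set [set: L],
      [set: R] #<= [set: L] &
      forall (A B : rmodType R) (i : {linear A -> B}), C B -> injective i ->
        exists (A' : rmodType R) (j : {linear A' -> B}),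
          [/\ A_embedding j,
              range i `<=` range j &
              [set: A'] #<= [set: (A + L)%type]]].

Definition is_LS (L : cardinal) : Prop :=
  LS_bound L /\ forall K : cardinal, LS_bound K -> [set: L] #<= [set: K].

(* The triples (b, A, N), for fixed A and fixed index type I of the tuple b.
   No generality is lost by fixing them: related triples share A and I. *)
Record triple (I : Type) (A : rmodType R) := Triple {
  tr_mod : rmodType R;
  tr_modP : C tr_mod;
  tr_incl : {linear A -> tr_mod};
  tr_inclP : injective tr_incl;
  tr_tuple : I -> tr_mod
}.

Definition atomically_related (I : Type) (A : rmodType R)
    (t1 t2 : triple I A) : Prop :=
  exists (N : rmodType R) (f1 : {linear tr_mod t1 -> N})
         (f2 : {linear tr_mod t2 -> N}),
    [/\ A_embedding f1, A_embedding f2,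
        forall a, f1 (tr_incl t1 a) = f2 (tr_incl t2 a) &
        forall i, f1 (tr_tuple t1 i) = f2 (tr_tuple t2 i)].

(* Triples form a class too large for [set] and [#<=], whose universes lie
   strictly below that of [lmodType]; Galois types and collections of them are
   therefore plain predicates, and "|gS(A)| <= L" is spelled out as the
   existence of a map to L that is injective on gS(A). *)
Definition gtp (I : Type) (A : rmodType R) (t : triple I A) :
    triple I A -> Prop :=
  Relation_Operators.clos_trans _ (@atomically_related I A) t.

Definition gS (A : rmodType R) (p : triple unit A -> Prop) : Prop :=
  exists t : triple unit A, A_embedding (tr_incl t) /\ p = gtp t.

Definition stable_in (L : cardinal) : Prop :=
  forall A : rmodType R, C A -> [set: A] #= [set: L] ->
    exists f : (triple unit A -> Prop) -> L,
      forall p q, gS p -> gS q -> f p = f q -> p = q.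

Definition stable : Prop :=
  exists K : cardinal, is_LS K /\
    exists L : cardinal, [set: K] #<= [set: L] /\ stable_in L.

End AbstractClass.

(* Main.v *)
From HB Require Import structures.
Require Import Defs.
From Stdlib Require Relation_Operators.
From mathcomp Require Import all_boot all_order all_algebra.
From mathcomp Require Import boolp classical_sets functions cardinality.

Set Implicit Arguments.
Unset Strict Implicit.
Unset Printing Implicit Defensive.

Import Order.TTheory GRing.Theory Num.Theory.
Local Open Scope ring_scope.
Local Open Scope classical_set_scope.
Local Open Scope card_scope.

(** Modules are written as left modules over [S], the converse ring.

    Membership in I_n is read off from finite linear systems. A family
    [x : 'I_q -> M] is a homomorphism S^q -> M, and a matrix [r] from S^p to
    S^q acts on such families by composition ([act]). If [r] is the first map of
    an exact sequence S^p -> S^q -> ... of n + 1 matrices, then Ext^(n+1) of the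
    cokernel of the last one with values in M vanishes exactly when every
    family over S^p that kills the kernel of [r] extends along [r], that is,
    when each consistent system with matrix [r] is solvable. This property,
    [ext_vanishes n M], is equivalent to injective dimension at most n when the
    ring is noetherian ([injdim_ext_vanishes], [ext_vanishes_injdim]): dimension
    shifting is [ext_vanishes_coker] and [ext_vanishes_ker], Baer's criterion
    settles n = 0, and enough injectives come from homomorphisms into Q/Z. In
    this form it is evident that I_n is closed under pure submodules, extensions
    and cokernels of embeddings.

    Let A be a submodule of N with both in I_n, and b in N. Close b under linear
    combinations and under a chosen solution, modulo A, of each solvable finite
    system. The result is the set of values of the terms of a type [W] which
    depends on the ring only, and its image in N/A is pure. Let P be the sum of A
    and this set, the [hull]. Then P/A is pure in N/A, which is in I_n as a
    cokernel, so P is in I_n as an extension ([hull_ext_vanishes]); and P is pure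
    (RD) in N whenever A is ([hull_reflects]). So P and N give b the same Galois
    type over A, for each of the three classes of embeddings.

    An element of P is a + eval w, and a + eval w = a' + eval w' exactly when
    the term w - w' has the value a' - a in A. So the partial map W -> A sending
    a term to its value, when that value is in A, determines P over A together
    with b, and the Galois type of b over A is determined by an element of
    W -> option A ([type_code_gtp]). There are |A + 1|^|W| of these, which is
    |A| if |A| = 2^|seq X| for some X into which W embeds ([stable_in_pow]), and
    X can be chosen so large that 2^|seq X| is at least the Loewenheim-Skolem
    number.

    That number exists because the closure of a submodule A' of B in I_n under
    chosen solutions of systems is pure, so in I_n, and has values of terms with
    variables in A' as elements: at most |A'| + |R| + aleph_0 of them, by
    [embeds_square]; a least bound exists because cardinals are well ordered
    ([least_cardinality]). *)

(** * Submodules, quotients and linear maps *)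

Section Submodules.
Variables (S : pzRingType) (M : lmodType S).

Definition is_submodule (P : M -> Prop) : Prop :=
  P 0 /\ forall s x y, P x -> P y -> P (s *: x + y).

Section Closure.
Variables (P : M -> Prop) (hP : is_submodule P).

Lemma submoduleD x y : P x -> P y -> P (x + y).
Proof. by move=> hx hy; rewrite -[x]scale1r; apply: (proj2 hP). Qed.

Lemma submoduleZ s x : P x -> P (s *: x).
Proof. by move=> hx; rewrite -[_ *: _]addr0; apply: (proj2 hP) => //; case: hP. Qed.

Lemma submoduleN x : P x -> P (- x).
Proof. by move=> hx; rewrite -scaleN1r; apply: submoduleZ. Qed.

Lemma submoduleB x y : P x -> P y -> P (x - y).
Proof. by move=> hx hy; apply: submoduleD => //; apply: submoduleN. Qed.

Definition submodule_pred : {pred M} := fun x => `[< P x >].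

Lemma submodule_pred_closed : submod_closed submodule_pred.
Proof.
split; first by apply/asboolP; case: hP.
by move=> s x y /asboolP hx /asboolP hy; apply/asboolP; apply: (proj2 hP).
Qed.
End Closure.

Variables (P : M -> Prop) (hP : is_submodule P).
HB.instance Definition _ := GRing.isSubmodClosed.Build S M
  (submodule_pred P) (submodule_pred_closed hP).

Definition submodule_type of is_submodule P := {x : M | x \in submodule_pred P}.
Local Notation subT := (submodule_type hP).

HB.instance Definition _ := SubChoice.on subT.
HB.instance Definition _ := [SubChoice_isSubLmodule of subT by <:].

(** From here on submodules and quotients are used through the two existence
    lemmas below, as an injective and as a surjective linear map. *)
Lemma submodule_inclusion :
  exists (A : lmodType S) (j : {linear A -> M}), injective j /\ range j = P.
Proof.
exists subT, (val : subT -> M); split; first exact: val_inj.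
apply/seteqP; split => [_ [x _ <-]|x hx]; first exact/asboolP/(valP x).
by exists (exist _ x (asboolT hx)).
Qed.

(** The quotient is carried by canonical representatives, so that its elements
    form a subtype of [M]. *)
Definition coset_repr (x : M) : M := xget 0 [set y | P (x - y)].

Lemma coset_reprP x : P (x - coset_repr x).
Proof.
rewrite /coset_repr; case: xgetP => [y _ //|/(_ x)].
by rewrite /= subrr => /(_ (proj1 hP)).
Qed.

Lemma eq_coset_repr x y : P (x - y) -> coset_repr x = coset_repr y.
Proof.
move=> hxy; rewrite /coset_repr; congr xget.
apply/seteqP; split => z /= h.
  have -> : y - z = (x - z) - (x - y) by rewrite opprB [RHS]addrC addrA subrK.
  exact: submoduleB.
have -> : x - z = (x - y) + (y - z) by rewrite addrA subrK.
exact: submoduleD.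
Qed.

Lemma coset_reprK x : coset_repr (coset_repr x) == coset_repr x.
Proof. by apply/eqP/esym/eq_coset_repr/coset_reprP. Qed.

Definition quotient_type of is_submodule P := {x : M | coset_repr x == x}.
Local Notation quoT := (quotient_type hP).
HB.instance Definition _ := Choice.on quoT.

Definition coset_of (x : M) : quoT := exist _ (coset_repr x) (coset_reprK x).

Lemma coset_ofE x y : coset_of x = coset_of y <-> P (x - y).
Proof.
split=> [/(congr1 val)/= e|h]; last exact/val_inj/eq_coset_repr.
have -> : x - y = (x - coset_repr x) - (y - coset_repr y).
  by rewrite e opprB addrA subrK.
by apply: submoduleB => //; apply: coset_reprP.
Qed.

Lemma coset_of_surj q : exists x, coset_of x = q.
Proof. by case: q => x hx; exists x; apply: val_inj; apply/eqP. Qed.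

Definition coset_opp (q : quoT) := coset_of (- val q).
Definition coset_add (q r : quoT) := coset_of (val q + val r).
Definition coset_scale s (q : quoT) := coset_of (s *: val q).

Lemma coset_addE x y : coset_add (coset_of x) (coset_of y) = coset_of (x + y).
Proof.
apply/coset_ofE => /=; rewrite opprD addrACA -opprB -[_ y - y]opprB.
by apply: submoduleD => //; apply: submoduleN => //; apply: coset_reprP.
Qed.

Lemma coset_scaleE s x : coset_scale s (coset_of x) = coset_of (s *: x).
Proof.
apply/coset_ofE => /=; rewrite -scalerBr -opprB; apply: submoduleZ => //.
by apply: submoduleN => //; apply: coset_reprP.
Qed.

Lemma coset_oppE x : coset_opp (coset_of x) = coset_of (- x).
Proof. by rewrite -scaleN1r -coset_scaleE /coset_scale scaleN1r. Qed.

Lemma coset_addA : associative coset_add.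
Proof.
move=> q r s; have [x <-] := coset_of_surj q; have [y <-] := coset_of_surj r.
by have [z <-] := coset_of_surj s; rewrite !coset_addE addrA.
Qed.

Lemma coset_addC : commutative coset_add.
Proof. by move=> q r; rewrite /coset_add addrC. Qed.

Lemma coset_add0 : left_id (coset_of 0) coset_add.
Proof. by move=> q; have [x <-] := coset_of_surj q; rewrite coset_addE add0r. Qed.

Lemma coset_addN : left_inverse (coset_of 0) coset_opp coset_add.
Proof.
by move=> q; have [x <-] := coset_of_surj q; rewrite coset_oppE coset_addE addNr.
Qed.

HB.instance Definition _ := GRing.isZmodule.Build quoT
  coset_addA coset_addC coset_add0 coset_addN.

Lemma coset_scaleA a b q : coset_scale a (coset_scale b q) = coset_scale (a * b) q.
Proof.
by have [x <-] := coset_of_surj q; rewrite !coset_scaleE scalerA.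
Qed.

Lemma coset_scale1 : left_id 1 coset_scale.
Proof. by move=> q; have [x <-] := coset_of_surj q; rewrite coset_scaleE scale1r. Qed.

Lemma coset_scaleDr : right_distributive coset_scale +%R.
Proof.
move=> s q r; have [x <-] := coset_of_surj q; have [y <-] := coset_of_surj r.
have -> : coset_of x + coset_of y = coset_of (x + y) := coset_addE x y.
by rewrite !coset_scaleE scalerDr -coset_addE.
Qed.

Lemma coset_scaleDl q : {morph coset_scale^~ q : a b / a + b}.
Proof.
by move=> a b; have [x <-] := coset_of_surj q; rewrite !coset_scaleE scalerDl -coset_addE.
Qed.

HB.instance Definition _ := GRing.Zmodule_isLmodule.Build S quoT
  coset_scaleA coset_scale1 coset_scaleDr coset_scaleDl.

Lemma coset_of_linear : linear coset_of.
Proof. by move=> s x y; rewrite -coset_addE -coset_scaleE. Qed.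

HB.instance Definition _ := GRing.isLinear.Build S M quoT _ coset_of coset_of_linear.

Lemma quotient_projection :
  exists (Q : lmodType S) (pr : {linear M -> Q}),
    (forall q, exists x, pr x = q) /\ forall x, pr x = 0 <-> P x.
Proof.
exists quoT, coset_of; split=> [|x]; first exact: coset_of_surj.
by rewrite -[x in P x]subr0; apply: coset_ofE.
Qed.
End Submodules.

Lemma range_submodule (S : pzRingType) (A B : lmodType S) (f : {linear A -> B}) :
  is_submodule (range f).
Proof.
split; first by exists 0; rewrite ?linear0.
by move=> s _ _ [x _ <-] [y _ <-]; exists (s *: x + y); rewrite ?linearP.
Qed.

(** Maps defined by choosing preimages are awkward to prove linear directly;
    it is enough to exhibit their graph. *)
Lemma linear_of_graph (S : pzRingType) (A B : lmodType S) (G : A -> B -> Prop) :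
  (forall a, exists b, G a b) ->
  (forall a b b', G a b -> G a b' -> b = b') ->
  (forall s a b a' b', G a b -> G a' b' -> G (s *: a + a') (s *: b + b')) ->
  exists g : {linear A -> B}, forall a, G a (g a).
Proof.
move=> /choice[g hg] Guniq Glin.
have glin : linear g.
  by move=> s x y; apply: Guniq (hg _) (Glin _ _ _ _ _ (hg _) (hg _)).
pose G' := GRing.isLinear.Build S A B _ g glin.
pose gl : {linear A -> B} := HB.pack g G'.
by exists gl.
Qed.

(** * Linear systems and the vanishing of Ext *)

Section Systems.
Variable S : pzRingType.
Implicit Types M N : lmodType S.

(** A family [x : 'I_q -> M] stands for a homomorphism from the free module of
    rows of length [q]; [act r x] is its composite with [v |-> v *m r]. *)
Definition act M p q (r : 'M[S]_(p, q)) (x : 'I_q -> M) : 'I_p -> M :=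
  fun i => \sum_j r i j *: x j.

Lemma actM M p q t (r : 'M[S]_(p, q)) (r' : 'M_(q, t)) (x : 'I_t -> M) :
  act (r *m r') x = act r (act r' x).
Proof.
apply/funext => i; rewrite /act.
under [RHS]eq_bigr do rewrite scaler_sumr.
rewrite exchange_big; apply: eq_bigr => j _ /=.
by rewrite mxE scaler_suml; apply: eq_bigr => k _; rewrite scalerA.
Qed.

Lemma act0 M p q (x : 'I_q -> M) : act (0 : 'M[S]_(p, q)) x = fun=> 0.
Proof.
by apply/funext => i; rewrite /act big1 // => j _; rewrite mxE scale0r.
Qed.

Lemma act_fun0 M p q (r : 'M[S]_(p, q)) : act r (fun=> 0 : M) = fun=> 0.
Proof.
by apply/funext => i; rewrite /act big1 // => j _; rewrite scaler0.
Qed.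

Lemma actD M p q (r : 'M[S]_(p, q)) (x y : 'I_q -> M) i :
  act r (fun j => x j + y j) i = act r x i + act r y i.
Proof. by rewrite /act -big_split; apply: eq_bigr => j _; rewrite scalerDr. Qed.

Lemma actB M p q (r : 'M[S]_(p, q)) (x y : 'I_q -> M) i :
  act r (fun j => x j - y j) i = act r x i - act r y i.
Proof. by rewrite /act -sumrB; apply: eq_bigr => j _; rewrite scalerBr. Qed.

Lemma act_linear M N (f : {linear M -> N}) p q (r : 'M[S]_(p, q)) x i :
  f (act r x i) = act r (f \o x) i.
Proof. by rewrite /act linear_sum; apply: eq_bigr => j _; rewrite linearZ. Qed.

Definition solvable M p q (r : 'M[S]_(p, q)) (m : 'I_p -> M) : Prop :=
  exists x, act r x = m.

(** As a homomorphism on rows, [m] vanishes on the kernel of [r]. Blocks [u] of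
    several rows are allowed so that relations compose as matrix products. *)
Definition consistent M p q (r : 'M[S]_(p, q)) (m : 'I_p -> M) : Prop :=
  forall t (u : 'M_(t, p)), u *m r = 0 -> act u m = fun=> 0.

Lemma solvable_consistent M p q (r : 'M[S]_(p, q)) (m : 'I_p -> M) :
  solvable r m -> consistent r m.
Proof. by move=> [x <-] t u hu; rewrite -actM hu act0. Qed.

Lemma consistent_linear M N (f : {linear M -> N}) p q (r : 'M[S]_(p, q)) m :
  consistent r m -> consistent r (f \o m).
Proof.
move=> hm t u /hm e; apply/funext => i.
by rewrite -act_linear e linear0.
Qed.

Lemma consistent_inj M N (f : {linear M -> N}) p q (r : 'M[S]_(p, q)) m :
  injective f -> consistent r (f \o m) -> consistent r m.
Proof.
move=> finj hm t u /hm e; apply/funext => i; apply: finj.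
by rewrite act_linear e linear0.
Qed.

Definition exact_at p q t (r : 'M[S]_(p, q)) (r' : 'M[S]_(q, t)) : Prop :=
  r *m r' = 0 /\
  forall k (v : 'M_(k, q)), v *m r' = 0 -> exists u : 'M_(k, p), v = u *m r.

(** The cokernel of [r] is an [n]-th syzygy: [r] is continued by [n] matrices to
    an exact sequence of free modules. *)
Fixpoint syzygy n p q (r : 'M[S]_(p, q)) : Prop :=
  if n is n'.+1 then
    exists t (r' : 'M[S]_(q, t)), exact_at r r' /\ syzygy n' r'
  else True.

Lemma syzygyW n p q (r : 'M[S]_(p, q)) : syzygy n.+1 r -> syzygy n r.
Proof.
elim: n p q r => // n IH p q r [t [r' [ex h]]].
by exists t, r'; split=> //; apply: IH.
Qed.

(** Ext^(n+1)(F, M) = 0 whenever F is the cokernel of the last matrix of an exact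
    sequence of [n] + 1 matrices; [r] is the first matrix of the sequence. *)
Definition ext_vanishes n M : Prop :=
  forall p q (r : 'M[S]_(p, q)) (m : 'I_p -> M),
    syzygy n r -> consistent r m -> solvable r m.

Lemma ext_vanishesW n M : ext_vanishes n M -> ext_vanishes n.+1 M.
Proof. by move=> h p q r m /syzygyW; apply: h. Qed.

Lemma ext_vanishes_sub n M N (f : {linear M -> N}) : injective f ->
  (forall p q (r : 'M[S]_(p, q)) m, solvable r (f \o m) -> solvable r m) ->
  ext_vanishes n N -> ext_vanishes n M.
Proof.
move=> finj hf hN p q r m hr hm; apply: hf; apply: hN => //.
exact: consistent_linear.
Qed.

Section ShortExact.
Variables (A N Q : lmodType S) (i : {linear A -> N}) (pr : {linear N -> Q}).
Hypotheses (iinj : injective i) (psurj : forall z, exists x, pr x = z).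
Hypothesis (exact_mid : forall x, pr x = 0 <-> exists a, i a = x).

Lemma lift_fun k (z : 'I_k -> Q) : exists x : 'I_k -> N, pr \o x = z.
Proof.
have /choice[g hg] := psurj.
by exists (g \o z); apply/funext => j /=.
Qed.

Lemma lift_ker k (x : 'I_k -> N) : pr \o x = (fun=> 0) ->
  exists a : 'I_k -> A, i \o a = x.
Proof.
move=> hx; have /choice[a ha] : forall j, exists a, i a = x j.
  by move=> j; apply/exact_mid; rewrite -[pr _]/((pr \o x) j) hx.
by exists a; apply/funext.
Qed.

Lemma proj_incl a : pr (i a) = 0.
Proof. by apply/exact_mid; exists a. Qed.

(** Dimension shifting. A consistent [m] in [Q] lifts to [m'] in [N], and the
    failure of [m'] to be consistent is a family [a] in [A] on the next syzygy.
    Since [A] extends that family, [m'] can be corrected by elements of [A]. *)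
Lemma ext_vanishes_coker n :
  (forall p q (r : 'M[S]_(p, q)), exists t (r' : 'M[S]_(t, p)), exact_at r' r) ->
  ext_vanishes n.+1 A -> ext_vanishes n N -> ext_vanishes n Q.
Proof.
move=> hker hA hN p q r m hr hm.
have [t [r' [r'r ex]]] := hker _ _ r.
have [m' em] := lift_fun m.
have [a ea] : exists a, i \o a = act r' m'.
  by apply: lift_ker; apply/funext => j; rewrite /= act_linear em hm.
have [y ey] : solvable r' a.
  apply: hA; first by exists q, r.
  apply: (consistent_inj iinj); rewrite ea.
  by apply: solvable_consistent; exists m'.
have [x ex'] : solvable r (fun j => m' j - i (y j)).
  apply: hN => // k u /ex[w ->]; rewrite actM.
  rewrite (_ : act r' _ = fun=> 0) ?act_fun0 //.
  apply/funext => j; rewrite actB -ea -ey /= act_linear.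
  by rewrite subrr.
exists (pr \o x); apply/funext => j.
rewrite -act_linear ex' linearB proj_incl subr0.
by rewrite -em.
Qed.

(** The opposite shift: solve in [N] first, read the solution in [Q] as a
    consistent family for the next matrix of the sequence, and subtract a lift
    of its solution. *)
Lemma ext_vanishes_ker n :
  ext_vanishes 0 N -> ext_vanishes n Q -> ext_vanishes n.+1 A.
Proof.
move=> hN hQ p q r m [t [r' [[rr' ex] hr']]] hm.
have [g eg] : solvable r (i \o m) by apply: hN => //; apply: consistent_linear.
have [h eh] : solvable r' (pr \o g).
  apply: hQ => // k v /ex[u ->]; rewrite actM.
  rewrite (_ : act r _ = fun=> 0) ?act_fun0 //.
  by apply/funext => j; rewrite -act_linear eg /= proj_incl.
have [h' eh'] := lift_fun h.
have [x ex'] : exists x, i \o x = (fun j => g j - act r' h' j).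
  apply: lift_ker; apply/funext => j /=.
  by rewrite linearB act_linear eh' eh subrr.
exists x; apply/funext => j; apply: iinj.
by rewrite act_linear ex' actB -actM rr' act0 subr0 eg.
Qed.
End ShortExact.
End Systems.

(** * Finite generation over noetherian rings *)

Section Span.
Variables (S : pzRingType) (M : lmodType S).

(** Defined by recursion rather than with a sum, so that closure properties
    follow by induction on the list. *)
Fixpoint span (s : seq M) (x : M) : Prop :=
  if s is a :: s' then exists c y, span s' y /\ x = c *: a + y else x = 0.

Lemma span_submodule s : is_submodule (span s).
Proof.
elim: s => [|a s [h0 h]]; first by split=> //= c x y -> ->; rewrite scaler0 addr0.
split; first by exists 0, 0; rewrite scale0r addr0.
move=> c x y [d [x' [hx ->]]] [e [y' [hy ->]]].
exists (c * d + e), (c *: x' + y'); split; first exact: h.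
by rewrite scalerDr scalerA scalerDl addrACA.
Qed.

Lemma span_le (P : M -> Prop) s : is_submodule P -> (forall x, x \in s -> P x) ->
  forall x, span s x -> P x.
Proof.
move=> hP; elim: s => [|a s IH] hs x /=; first by move=> ->; case: hP.
move=> [c [y [hy ->]]]; apply: (proj2 hP); first by apply: hs; rewrite mem_head.
by apply: IH hy => z hz; apply: hs; rewrite inE hz orbT.
Qed.

Lemma span_cat s t x y : span s x -> span t y -> span (s ++ t) (x + y).
Proof.
elim: s x => [|a s IH] x /=; first by move=> -> ?; rewrite add0r.
by move=> [c [z [hz ->]]] hy; exists c, (z + y); rewrite addrA; split=> //; apply: IH.
Qed.

Lemma span_mem s x : x \in s -> span s x.
Proof.
elim: s => //= a s IH; rewrite inE => /orP[/eqP ->|/IH h].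
  by exists 1, 0; rewrite scale1r addr0; split=> //; case: (span_submodule s).
by exists 0, x; rewrite scale0r add0r.
Qed.

Lemma span_sum s x : span s x ->
  exists u : 'I_(size s) -> S, x = \sum_j u j *: s`_j.
Proof.
elim: s x => [|a s IH] x /=; first by move=> ->; exists (fun=> 0); rewrite big_ord0.
move=> [c [y [/IH[u ->] ->]]].
exists (fun j => if unlift ord0 j is Some k then u k else c).
rewrite big_ord_recl unlift_none /=; congr (_ + _).
by apply: eq_bigr => j _; rewrite liftK.
Qed.

Definition finitely_generated (P : M -> Prop) : Prop :=
  exists s, forall x, P x <-> span s x.
End Span.

Definition noetherian (S : pzRingType) : Prop :=
  forall I : S^o -> Prop, is_submodule I -> finitely_generated I.

(** If [I] is not finitely generated, repeatedly adding an element of [I]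
    outside the span of the previous ones gives a strictly increasing chain. *)
Lemma right_noetherian_converse (R : pzRingType) :
  right_noetherian R -> noetherian R^c.
Proof.
move=> hR I hI; apply: contrapT => nfg.
have /choice[pick hpick] : forall s : seq (R^c)^o, exists a,
    (forall x, x \in s -> I x) -> I a /\ ~ span s a.
  move=> s; have [hs|hs] := pselect (forall x, x \in s -> I x); last by exists 0.
  apply: contrapT => h; apply: nfg; exists s => x; split; last exact: span_le.
  by move=> hx; apply: contrapT => hxs; apply: h; exists x.
pose l := fix l k := if k is k'.+1 then pick (l k') :: l k' else [::].
have lI : forall k x, x \in l k -> I x.
  elim=> // k IH x; rewrite inE => /orP[/eqP ->|]; last exact: IH.
  by have [] := hpick _ (IH).
have [k hk] : exists k, forall j, (k <= j)%N -> (span (l j) : set R) = span (l k).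
  apply: hR => [k|k x hx]; last first.
    by exists 0, x; rewrite scale0r add0r.
  have [h0 h] := span_submodule (l k); split=> // [x y hx hy|x r hx].
    by rewrite addrC -[- y]mulrN1; exact: (h (-1) y x hy hx).
  have := h (r : R^c) x 0 hx h0; rewrite addr0. exact.
have [_ h] := hpick _ (lI k); apply: h; rewrite -(hk k.+1) //.
by exists 1, 0; rewrite scale1r addr0; split=> //; case: (span_submodule (l k)).
Qed.

(** Induction on the number [k] of coordinates that may be nonzero: the entries
    in the last of these coordinates form an ideal, and generators of this ideal
    lift to elements that reduce the problem to [k] - 1 coordinates. *)
Lemma noetherian_rV (S : pzRingType) q (P : 'rV[S]_q -> Prop) :
  noetherian S -> is_submodule P -> finitely_generated P.
Proof.
move=> hS.
suff H k : forall P : 'rV[S]_q -> Prop, is_submodule P ->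
    (forall v (j : 'I_q), P v -> (k <= j)%N -> v 0 j = 0) -> finitely_generated P.
  by move=> hP; apply: (H q) => // v j _; rewrite leqNgt ltn_ord.
elim: k => [|k IH] {}P hP hk.
  exists [::] => v; split=> [hv|->]; last by case: hP.
  by apply/rowP => j; rewrite mxE; apply: hk.
have [kq|kq] := ltnP k q; last first.
  by apply: IH => // v j hv /(leq_trans kq); rewrite leqNgt ltn_ord.
pose K := Ordinal kq.
pose I (a : S^o) := exists v, P v /\ v 0 K = a.
have hI : is_submodule I.
  split; first by exists 0; rewrite mxE; split=> //; case: hP.
  move=> c a b [v [hv <-]] [w [hw <-]]; exists (c *: v + w).
  by rewrite !mxE; split=> //; apply: (proj2 hP).
have [c hc] := hS _ hI.
have /choice[g hg] : forall a, exists v, I a -> P v /\ v 0 K = a.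
  move=> a; have [[v hv]|h] := pselect (I a); first by exists v.
  by exists 0.
have [t ht] : finitely_generated (fun v => P v /\ v 0 K = 0).
  apply: IH => [|v j [hv hv0]].
    split=> [|d v w [hv v0] [hw w0]]; first by rewrite mxE; split=> //; case: hP.
    by split; [apply: (proj2 hP)|rewrite !mxE v0 w0 mulr0 addr0].
  rewrite leq_eqVlt => /orP[/eqP kj|]; last exact: hk.
  by rewrite -hv0; congr (v _ _); apply: val_inj.
have hcI a : a \in c -> I a by move=> /span_mem /hc.
exists (map g c ++ t) => v; split=> [hv|]; last first.
  apply: span_le => // w; rewrite mem_cat => /orP[/mapP[a /hcI/hg[ha _] ->] //|].
  by move=> /span_mem/ht[].
have {hc} : span c (v 0 K) by apply/hc; exists v.
have hgc : forall a, span c a -> exists w, [/\ span (map g c) w, P w & w 0 K = a].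
  elim: (c) hcI => [|b c' IHc] hb a /=.
    by move=> ->; exists 0; rewrite mxE; split=> //; case: hP.
  move=> [d [y [hy ->]]].
  have [|w [hw Pw wy]] := IHc _ y hy.
    by move=> z hz; apply: hb; rewrite inE hz orbT.
  have [Pb eb] := hg b (hb b (mem_head _ _)).
  exists (d *: g b + w); split; [by exists d, w|exact: (proj2 hP)|].
  by rewrite !mxE wy eb.
move=> /hgc[w [hw Pw ew]]; rewrite -[v](subrK w) addrC; apply: span_cat => //.
by apply/ht; split; [exact: submoduleB|rewrite !mxE ew subrr].
Qed.

Lemma noetherian_kernel (S : pzRingType) : noetherian S ->
  forall p q (r : 'M[S]_(p, q)), exists t (r' : 'M[S]_(t, p)), exact_at r' r.
Proof.
move=> hS p q r.
have [|s hs] := noetherian_rV hS (P := fun v : 'rV[S]_p => v *m r = 0).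
  by split=> [|c v w hv hw]; rewrite ?mul0mx // mulmxDl -scalemxAl hv hw scaler0 addr0.
exists (size s), (\matrix_(i < size s) s`_i); split=> [|k v hv].
  apply/row_matrixP => i; rewrite row_mul rowK row0; apply/hs/span_mem.
  exact: mem_nth.
have /choice[u hu] : forall i, exists u : 'I_(size s) -> S, row i v = \sum_j u j *: s`_j.
  by move=> i; apply/span_sum/hs; rewrite -row_mul hv row0.
exists (\matrix_(i, j) u i j); apply/row_matrixP => i.
rewrite row_mul mulmx_sum_row hu; apply: eq_bigr => j _.
by rewrite !mxE rowK.
Qed.

(** * Baer's criterion *)

(** The usual form of Zorn's lemma for sets, with chains assumed nonempty in
    exchange for a starting element [A0]. *)
Lemma Zorn_above T (P : set (set T)) (A0 : set T) : P A0 ->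
  (forall F : set (set T), F `<=` P -> F !=set0 -> total_on F subset ->
    P (\bigcup_(X in F) X)) ->
  exists A, [/\ P A, A0 `<=` A & forall B, P B -> A `<=` B -> B `<=` A].
Proof.
move=> PA0 hP; pose P' X := X = set0 \/ (P X /\ A0 `<=` X).
have [F FP' Ftot|A [P'A Amax]] := @Zorn_bigcup T P'.
  have [[X [FX [PX A0X]]]|h] := pselect (exists X, F X /\ (P X /\ A0 `<=` X)); last first.
    left; apply/seteqP; split => // x [X FX Xx].
    have [X0|hX] := FP' X FX; first by rewrite X0 in Xx.
    by case: h; exists X.
  pose F' := F `&` [set Y | P Y /\ A0 `<=` Y].
  have -> : \bigcup_(Y in F) Y = \bigcup_(Y in F') Y.
    apply/seteqP; split => x [Y FY Yx]; exists Y => //; last by case: FY.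
    split=> //; have [Y0|//] := FP' Y FY.
    by rewrite Y0 in Yx.
  right; split; last by move=> x /A0X Xx; exists X.
  apply: hP => [Y [_ []] //||Y Z [FY _] [FZ _]]; last exact: Ftot.
  by exists X.
have A0A : A0 `<=` A.
  apply: contrapT => nA0A; apply: (Amax A0); last by right; split.
  by split=> //; case: P'A => [->|[_ //]]; apply: sub0set.
have PA : P A.
  case: P'A => [A_0|[] //]; suff -> : A = A0 by [].
  by apply/seteqP; split=> //; rewrite A_0.
exists A; split=> // B PB AB; apply: contrapT => nBA.
by apply: (Amax B) => //; right; split=> //; apply: subset_trans AB.
Qed.

Definition is_injective (S : pzRingType) (E : lmodType S) : Prop :=
  forall (A B : lmodType S) (i : {linear A -> B}) (f : {linear A -> E}),
    injective i -> exists g : {linear B -> E}, forall a, g (i a) = f a.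

Section Baer.
Variables (S : pzRingType) (E : lmodType S).

(** Injectivity tested on ideals of [S] only; an ideal is given by its
    inclusion [j]. *)
Definition baer_test : Prop :=
  forall (A : lmodType S) (j : {linear A -> S^o}) (f : {linear A -> E}),
    injective j -> exists e, forall a, f a = (j a : S) *: e.

(** [G] is the graph of a linear map defined on a submodule of [B]. *)
Definition partial_linear (B : lmodType S) (G : set (B * E)) : Prop :=
  (forall s b e b' e', G (b, e) -> G (b', e') -> G (s *: b + b', s *: e + e')) /\
  (forall e, G (0, e) -> e = 0).

Lemma partial_linear_uniq (B : lmodType S) (G : set (B * E)) b e e' :
  partial_linear G -> G (b, e) -> G (b, e') -> e = e'.
Proof.
move=> [Glin G0] h h'; apply/esym/eqP; rewrite -subr_eq0; apply/eqP/G0.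
by have := Glin (-1) _ _ _ _ h h'; rewrite !scaleN1r addNr addrC.
Qed.

(** A maximal extension of [G0] is total: for [b] in [B], the scalars [s] with
    [s *: b] in the domain form an ideal, the test gives a value [e] for [b] which
    agrees with the map there, and the domain can be enlarged by [b]. *)
Lemma baer_extend (B : lmodType S) (G0 : set (B * E)) :
  baer_test -> G0 (0, 0) -> partial_linear G0 ->
  exists g : {linear B -> E}, forall b e, G0 (b, e) -> g b = e.
Proof.
move=> hE G00 hG0.
have [|F FP [X0 FX0] Ftot|G [hG G0G Gmax]] := @Zorn_above _ (@partial_linear B) G0.
- exact: hG0.
- split=> [s b e b' e' [X FX Xb] [Y FY Yb]|e [X FX Xe]]; last exact: (proj2 (FP X FX)).
  by have [XY|YX] := Ftot X Y FX FY;
    [exists Y => //; apply: (proj1 (FP Y FY)) => //; apply: XY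
    |exists X => //; apply: (proj1 (FP X FX)) => //; apply: YX].
have [Glin G0e] := hG; have G00' := G0G _ G00.
have Gtot b : exists e, G (b, e).
  have [|A [j [jinj hj]]] := @submodule_inclusion S S^o
      (fun s : S^o => exists e, G ((s : S) *: b, e)).
    split; first by exists 0; rewrite scale0r.
    move=> s x y [e he] [e' he']; exists (s *: e + e').
    by rewrite scalerDl -scalerA; apply: Glin.
  have [||s a e a' e' h h'|f hf] := @linear_of_graph S A E
      (fun a e => G ((j a : S) *: b, e)).
  - by move=> a; have : range j (j a) by [exists a]; rewrite hj.
  - by move=> a e e'; apply: partial_linear_uniq hG.
  - by rewrite linearP scalerDl -scalerA; apply: Glin.
  have [e he] := hE A j f jinj; exists e.
  pose G' : set (B * E) := [set z | exists s x y,
    [/\ G (x, y), z.1 = x + s *: b & z.2 = y + s *: e]].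
  suff GG' : G' `<=` G by apply: GG'; exists 1, 0, 0; split; rewrite /= ?scale1r ?add0r.
  apply: Gmax; last by move=> [x y] h; exists 0, x, y; split; rewrite /= ?scale0r ?addr0.
  split=> [s b1 e1 b2 e2 [s1 [x1 [y1 [h1 /= -> ->]]]] [s2 [x2 [y2 [h2 /= -> ->]]]]|].
    exists (s * s1 + s2), (s *: x1 + x2), (s *: y1 + y2).
    split=> /=; first exact: Glin.
      by rewrite scalerDr scalerA scalerDl addrACA.
    by rewrite scalerDr scalerA scalerDl addrACA.
  move=> e0 [s [x [y [h /= /esym/eqP]]]]; rewrite addr_eq0 => /eqP xE ->.
  have hs : G (s *: b, - y).
    have := Glin (-1) _ _ _ _ h G00'; rewrite !scaleN1r !addr0 xE opprK; exact.
  have [a _ ja] : range j s by rewrite hj; exists (- y).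
  rewrite -ja -he; apply/eqP; rewrite addrC addr_eq0; apply/eqP.
  by apply: partial_linear_uniq hG _ hs; rewrite -ja; apply: hf.
have [||s a e a' e'|g hg] := @linear_of_graph S B E (fun b e => G (b, e)).
- exact: Gtot.
- by move=> a e e'; apply: partial_linear_uniq hG.
- exact: Glin.
by exists g => b e /G0G h; apply: partial_linear_uniq hG (hg b) h.
Qed.

Lemma baer_injective : baer_test -> is_injective E.
Proof.
move=> hE A B i f iinj.
have [||g hg] :=
    @baer_extend B [set z | exists a, z = (i a, f a)] hE.
- by exists 0; rewrite !linear0.
- split=> [s b e b' e' [a [-> ->]] [a' [-> ->]]|e [a [/esym/eqP]]].
    by exists (s *: a + a'); rewrite !linearP.
  by rewrite raddf_eq0 // => /eqP -> ->; rewrite linear0.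
by exists g => a; apply: hg; exists a.
Qed.

(** A homomorphism on an ideal with generators [s_i] is a consistent
    right-hand side for the one-column system [s_i * x = m_i], and a solution [x]
    extends it. *)
Lemma ext_vanishes_baer : noetherian S -> ext_vanishes 0 E -> baer_test.
Proof.
move=> hS hE A j f jinj.
have [s hs] := hS _ (range_submodule j).
have /choice[a ha] : forall i : 'I_(size s), exists a, j a = s`_i.
  move=> i; have : range j s`_i by apply/hs/span_mem/mem_nth.
  by case=> a _ <-; exists a.
have [//||x hx] := @hE _ _ (\matrix_(i < size s, k < 1) (s`_i : S)) (f \o a).
  move=> t u hu; apply/funext => k; rewrite -act_linear.
  suff -> : act u a k = 0 by rewrite linear0.
  apply: jinj; rewrite linear0 act_linear.
  have := congr1 (fun M : 'M[S]_(t, 1) => M k 0) hu; rewrite !mxE => <-.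
  by apply: eq_bigr => i _; rewrite mxE /= ha.
exists (x 0) => b.
have /hs/span_sum[u hu] : range j (j b) by exists b.
have -> : b = \sum_i u i *: a i.
  apply: jinj; rewrite hu linear_sum; apply: eq_bigr => i _.
  by rewrite linearZ ha.
rewrite !linear_sum scaler_suml; apply: eq_bigr => i _.
rewrite !linearZ /= -[f (a i)]/((f \o a) i) -hx /act big_ord1 mxE ha.
by rewrite scalerA.
Qed.

(** A consistent family is a homomorphism on the row space of [r]; its extension
    to all rows is a solution. *)
Lemma injective_ext_vanishes : is_injective E -> ext_vanishes 0 E.
Proof.
move=> hE p q r m _ hm.
have [|A [j [jinj hj]]] := @submodule_inclusion S 'rV_q
    (fun v : 'rV[S]_q => exists u : 'rV_p, v = u *m r).
  split; first by exists 0; rewrite mul0mx.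
  by move=> s _ _ [u ->] [v ->]; exists (s *: u + v); rewrite mulmxDl scalemxAl.
have actP s u v : act (s *: u + v : 'rV_p) m 0 = s *: act u m 0 + act v m 0.
  rewrite /act scaler_sumr -big_split; apply: eq_bigr => k _ /=.
  by rewrite !mxE scalerDl scalerA.
have [|a e e'|s a e a' e'|f hf] := @linear_of_graph S A E
    (fun a e => exists u, j a = u *m r /\ e = act u m 0).
- move=> a; have : range j (j a) by [exists a].
  by rewrite hj => -[u hu]; exists (act u m 0), u.
- move=> [u [hu ->]] [v [hv ->]]; apply/eqP; rewrite -subr_eq0.
  have := hm _ (-1 *: v + u); rewrite mulmxDl -scalemxAl -hu -hv scaleN1r addNr.
  by move=> /(_ erefl)/(congr1 (fun h => h 0)); rewrite actP scaleN1r addrC => ->.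
- move=> [u [hu ->]] [v [hv ->]]; exists (s *: u + v).
  by rewrite linearP hu hv mulmxDl scalemxAl actP.
have [g hg] := hE _ _ j f jinj.
exists (fun k => g (delta_mx 0 k)); apply/funext => i.
have e1 : act r (fun k => g (delta_mx 0 k)) i = g (delta_mx 0 i *m r).
  rewrite -rowE [row i r]row_sum_delta linear_sum; apply: eq_bigr => k _.
  by rewrite linearZ mxE.
have [a _ ja] : range j (delta_mx 0 i *m r) by rewrite hj; exists (delta_mx 0 i).
rewrite e1 -ja hg; have [u [hu ->]] := hf a.
have := hm _ (-1 *: delta_mx 0 i + u); rewrite mulmxDl -scalemxAl -hu ja scaleN1r addNr.
move=> /(_ erefl)/(congr1 (fun h => h 0)); rewrite actP scaleN1r => /eqP.
rewrite addrC subr_eq0 => /eqP ->; rewrite /act (bigD1 i) //= mxE !eqxx scale1r.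
by rewrite big1 ?addr0 // => k /negPf ki; rewrite mxE ki andbF scale0r.
Qed.
End Baer.

(** * Injective abelian groups *)

Lemma int_ideal_principal (I : int^o -> Prop) : is_submodule I ->
  exists2 d : int, I d & forall a, I a -> exists k : int, a = k * d.
Proof.
move=> hI; have [[d0 [Id0 d0n]]|h] := pselect (exists d, I d /\ d != 0); last first.
  exists 0; first by case: hI.
  move=> a Ia; exists 0; apply/eqP; rewrite mul0r; apply: contrapT => /negP ha.
  by apply: h; exists a.
have ex : exists n : nat, (0 < n)%N && `[< I n%:Z >].
  exists `|d0|%N; rewrite absz_gt0 d0n; apply/asboolP.
  rewrite abszE; have [_|_] := ger0P d0 => //.
  by have := submoduleN hI Id0.
have [n /andP[n0 /asboolP In] nmin] := ex_minnP ex.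
exists n%:Z => // a Ia; exists (a %/ n)%Z.
have nz : n%:Z != 0 by rewrite -lt0n.
have : I (a %% n)%Z.
  rewrite /modz; by have := submoduleB hI Ia (submoduleZ hI (a %/ n)%Z In).
have := modz_ge0 a nz; have := ltz_pmod a (n0 : 0 < n%:Z).
case ea: (a %% n)%Z => [k|//] kn _ Ik.
suff k0 : k = 0%N by rewrite [LHS](divz_eq a n) ea k0 addr0.
apply/eqP; rewrite -leqn0 leqNgt; apply/negP => kgt0.
have := nmin k; rewrite kgt0 => /(_ (asboolT Ik)).
by rewrite leqNgt; move: kn; rewrite ltz_nat => ->.
Qed.

(** This is Q/Z: it passes Baer's test because it is divisible. A nonzero [x]
    generates a cyclic group Z/d or Z; map [x] to 1/d, or to 1/2 in the second
    case. Here [d] generates the annihilator of [x], so it is 0 if [x] has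
    infinite order. *)
Lemma injective_separating_group : exists D : lmodType int,
  is_injective D /\ forall (M : lmodType int) (x : M), x != 0 ->
     exists chi : {linear M -> D}, chi x != 0.
Proof.
pose Z (x : zmodule rat) := exists n : int, x = n%:~R.
have [|D [pr [psurj pker]]] := @quotient_projection int (zmodule rat) Z.
  split; first by exists 0.
  by move=> s _ _ [m ->] [n ->]; exists (s * m + n); rewrite scalezrE intrD intrM mulrzl.
have hD : baer_test D.
  move=> A j f jinj.
  have [d [a0 _ ja0] hd] := int_ideal_principal (range_submodule j).
  have [x hx] := psurj (f a0).
  have fk a : exists k : int, a = k *: a0.
    have [|k hk] := hd (j a); first by exists a.
    by exists k; apply: jinj; rewrite linearZ hk -ja0.
  have [d0|dn0] := eqVneq d 0.
    exists 0 => a; rewrite scaler0; have [k ->] := fk a.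
    have -> : a0 = 0 by apply: jinj; rewrite ja0 d0 linear0.
    by rewrite scaler0 linear0.
  exists (pr (x / d%:~R : rat)) => a; have [k ->] := fk a.
  rewrite !linearZ /= -scalerA ja0; congr (_ *: _).
  rewrite -hx -linearZ; congr (pr _).
  rewrite scalezrE; rewrite -mulrzl mulrC mulfVK // intr_eq0 //.
exists D; split; first exact: baer_injective.
move=> M x xn0.
have [|d xd hd] := @int_ideal_principal (fun n : int^o => (n : int) *: x = 0).
  split; first by rewrite scale0r.
  by move=> s m n hm hn; rewrite scalerDl -scalerA hm hn scaler0 addr0.
pose c : rat := if d == 0 then 2^-1 else d%:~R^-1.
have hc (n : int) : n *: x = 0 -> n *: pr (c : zmodule rat) = 0.
  move=> /hd[k ->]; rewrite -linearZ; apply/pker; rewrite scalezrE -mulrzl /c.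
  have [->|dn0] := eqVneq d 0; first by exists 0; rewrite mulr0 mul0r.
  by exists k; rewrite intrM mulfK // intr_eq0.
have cn0 : pr (c : zmodule rat) != 0.
  apply/eqP => /pker[n]; rewrite /c; have [d0|dn0] := eqVneq d 0.
    move=> e; have : n * 2 = 1.
      by apply/eqP; rewrite -(eqr_int rat) intrM -e mulVf.
    by move=> /(congr1 (fun z => (z %% 2)%Z)); rewrite modzMl.
  move=> e; have nd : n * d = 1.
    by apply/eqP; rewrite -(eqr_int rat) intrM -e mulVf // intr_eq0.
  by move: xn0; rewrite -[x]scale1r -nd -scalerA xd scaler0 eqxx.
have [||chi hchi] := @baer_extend int D M
    [set z | exists n : int, z = (n *: x, n *: pr (c : zmodule rat))] hD.
- by exists 0; rewrite !scale0r.
- split=> [s b e b' e' [m [-> ->]] [n [-> ->]]|e [n [/esym hn ->]]]; last exact: hc.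
  by exists (s * m + n); rewrite !scalerDl !scalerA.
by exists chi; rewrite (hchi x (pr (c : zmodule rat))) //; exists 1; rewrite !scale1r.
Qed.

(** * Enough injective modules *)

(** Abelian groups become modules over [int] through the alias [zmodule]. *)
Lemma additive_int_linear (A : zmodType) (D : lmodType int) (f : A -> D) :
  {morph f : a b / a + b} ->
  exists g : {linear zmodule A -> D}, forall a, g a = f a.
Proof.
move=> fD.
have fB : {morph f : a b / a - b}.
  by move=> a b; apply: (addIr (f b)); rewrite -fD !subrK.
pose fa : {additive A -> D} := HB.pack f (GRing.isZmodMorphism.Build _ _ f fB).
have fl : linear (f : zmodule A -> D).
  move=> n a b; rewrite fD; congr (_ + _).
  by rewrite scalezrE -[n in RHS]intz scaler_int; apply: (raddfMz fa).
pose g : {linear zmodule A -> D} :=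
  HB.pack (f : zmodule A -> D) (GRing.isLinear.Build _ _ _ _ _ fl).
by exists g.
Qed.

Section Coinduced.
Variables (S : pzRingType) (X : Type) (D : lmodType int).

Definition additive_pred : {pred S -> X -> D} :=
  fun f => `[< forall a b, f (a + b) = f a + f b >].

Lemma additive_predP f :
  reflect (forall a b, f (a + b) = f a + f b) (f \in additive_pred).
Proof. exact: asboolP. Qed.

Lemma additive_pred_closed : zmod_closed additive_pred.
Proof.
split=> [|f g /additive_predP hf /additive_predP hg]; apply/additive_predP => a b.
  by apply/funext => x; rewrite /= addr0.
rewrite -[LHS]/(f (a + b) - g (a + b)) hf hg.
by apply/funext => x; rewrite /= opprD addrACA.
Qed.

HB.instance Definition _ := GRing.isZmodClosed.Build _ additive_pred additive_pred_closed.

(** The coinduced module Hom_Z(S, D^X), with [(s f)(a) = f(a s)]. Taking a power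
    of [D] allows one character for each element of the module to embed. *)
Definition coinduced := {f : S -> X -> D | f \in additive_pred}.
HB.instance Definition _ := SubChoice.on coinduced.
HB.instance Definition _ := [SubChoice_isSubZmodule of coinduced by <:].

Lemma coinduced_scale_subproof s (f : coinduced) :
  (fun a => val f (a * s)) \in additive_pred.
Proof.
apply/additive_predP => a b; rewrite mulrDl.
by have /additive_predP -> := valP f.
Qed.

Definition coinduced_scale s (f : coinduced) : coinduced :=
  exist (fun f => f \in additive_pred) _ (coinduced_scale_subproof s f).

Lemma coinduced_scaleA a b f :
  coinduced_scale a (coinduced_scale b f) = coinduced_scale (a * b) f.
Proof. by apply: val_inj; apply/funext => c /=; rewrite mulrA. Qed.

Lemma coinduced_scale1 : left_id 1 coinduced_scale.
Proof. by move=> f; apply: val_inj; apply/funext => c /=; rewrite mulr1. Qed.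

Lemma coinduced_scaleDr : right_distributive coinduced_scale +%R.
Proof. by move=> s f g; apply: val_inj. Qed.

Lemma coinduced_scaleDl f : {morph coinduced_scale^~ f : a b / a + b}.
Proof.
move=> a b; apply: val_inj; apply/funext => c /=; rewrite mulrDr.
by have /additive_predP -> := valP f.
Qed.

HB.instance Definition _ := GRing.Zmodule_isLmodule.Build S coinduced
  coinduced_scaleA coinduced_scale1 coinduced_scaleDr coinduced_scaleDl.

(** Half of the adjunction: additive maps B -> D^X induce linear maps from [B]
    to the coinduced module. *)
Lemma coinduced_hom (B : lmodType S) (h : X -> {linear zmodule B -> D}) :
  exists g : {linear B -> coinduced},
    forall b s x, val (g b) s x = h x (s *: b).
Proof.
have hadd (b : B) : (fun (s : S) x => h x (s *: b)) \in additive_pred.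
  by apply/additive_predP => a c; apply/funext => x /=; rewrite scalerDl linearD.
have [||s b _ c _ -> ->|g hg] := @linear_of_graph S B coinduced
  (fun b q => q = exist (fun f => f \in additive_pred) _ (hadd b)).
- by move=> b; exists (exist (fun f => f \in additive_pred) _ (hadd b)).
- by move=> b q q' -> ->.
- apply: val_inj; apply/funext => a; apply/funext => x /=.
  by rewrite scalerDr scalerA linearD.
by exists g => b s x; rewrite hg.
Qed.

(** By the adjunction, extending a linear map to the coinduced module amounts
    to extending, for each [x], the additive map [a |-> f a 1 x]. *)
Lemma coinduced_injective : is_injective D -> is_injective coinduced.
Proof.
move=> hD A B i f iinj.
have hx x : exists h : {linear zmodule B -> D}, forall a, h (i a) = val (f a) 1 x.
  have [i' hi'] :=
    additive_int_linear (fun a b => raddfD i a b : _ = i a + i b :> zmodule B).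
  have [|f' hf'] := @additive_int_linear A D (fun a => val (f a) 1 x).
    by move=> a b; rewrite linearD.
  have [|h hh] := hD _ _ i' f'; first by move=> a b; rewrite !hi' => /iinj.
  by exists h => a; rewrite -hf' -hi' hh.
have /choice[h hh] := hx.
have [g hg] := coinduced_hom h.
exists g => a; apply: val_inj; apply/funext => s; apply/funext => x.
by rewrite hg -linearZ hh linearZ /= mul1r.
Qed.
End Coinduced.

Lemma enough_injectives (S : pzRingType) (M : lmodType S) :
  exists (E : lmodType S) (i : {linear M -> E}), is_injective E /\ injective i.
Proof.
have [D [hD hsep]] := injective_separating_group.
have /choice[chi hchi] : forall x : M, exists chi : {linear zmodule M -> D},
    x != 0 -> chi x != 0.
  move=> x; have [_|xn0] := eqVneq x 0; first by exists \0.
  by have [chi hchi] := hsep (zmodule M) x xn0; exists chi.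
have [i hi] := coinduced_hom chi.
exists (coinduced S M D), i; split; first exact: coinduced_injective.
apply/raddf_inj => x ix; apply/eqP; apply: contrapT => /negP /hchi /eqP; apply.
by rewrite -[x in chi x x]scale1r -hi ix.
Qed.

(** * Injective dimension in terms of linear systems *)

Lemma ext_vanishes_le (S : pzRingType) n (E : lmodType S) :
  ext_vanishes 0 E -> ext_vanishes n E.
Proof. by elim: n => // n IH /IH; apply: ext_vanishesW. Qed.

(** Induction along the resolution: the image of [d 0] is the cokernel of [eta]
    and is resolved by the rest of the sequence. *)
Lemma injdim_ext_vanishes (R : pzRingType) n (M : rmodType R) :
  injdim_le n M -> ext_vanishes n M.
Proof.
elim: n M => [|n IH] M [E [eta [d [Einj etainj ex0 ex E0]]]].
  apply: (ext_vanishes_sub etainj); last exact/injective_ext_vanishes/Einj.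
  move=> p q r m [x hx].
  have /choice[y hy] : forall k, exists y, eta y = x k.
    move=> k; have : range eta (x k) by rewrite ex0; apply: E0.
    by case=> y _; exists y.
  exists y; apply/funext => i; apply: etainj.
  rewrite act_linear -[RHS]/((eta \o m) i) -hx; congr (act r _ i).
  by apply/funext => k /=.
have [A [j [jinj hj]]] := submodule_inclusion (range_submodule (d 0%N)).
have [x|x a b ea eb|s x a y b ea eb|pr hpr] :=
    @linear_of_graph R^c (E 0%N) A (fun x a => j a = d 0%N x).
- have : range j (d 0%N x) by rewrite hj; exists x.
  by case=> a _; exists a.
- by apply: jinj; rewrite ea.
- by rewrite !linearP ea eb.
apply: (@ext_vanishes_ker _ _ _ _ eta pr) => //.
- move=> a; have [x _ dx] : range (d 0%N) (j a) by rewrite -hj; exists a.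
  by exists x; apply: jinj; rewrite hpr.
- move=> x; have -> : pr x = 0 <-> d 0%N x = 0.
    rewrite -hpr; split=> [->|h]; first by rewrite linear0.
    by apply: jinj; rewrite h linear0.
  have -> : d 0%N x = 0 <-> range eta x by rewrite ex0.
  by split=> [[a _ <-]|[a <-]]; exists a.
- exact/injective_ext_vanishes/Einj.
apply: IH; exists (fun i => E i.+1), j, (fun i => d i.+1); split=> //.
- by rewrite hj ex.
- by move=> i ni; apply: E0.
Qed.

(** Embed [M] in an injective module; the cokernel satisfies the condition for
    [n] - 1, and its resolution is prolonged by one step. *)
Lemma ext_vanishes_injdim (R : pzRingType) n (M : rmodType R) :
  noetherian R^c -> ext_vanishes n M -> injdim_le n M.
Proof.
move=> hR; elim: n M => [|n IH] M hM.
  pose E i : rmodType R := if i is 0%N then M else 'rV[R^c]_0.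
  exists E, (idfun : {linear M -> E 0%N}), (fun i => \0 : {linear E i -> E i.+1}).
  have E0 : forall i (x : E i.+1), x = 0 by move=> i x; apply/rowP => -[].
  split.
  - case=> [|i]; first exact/baer_injective/ext_vanishes_baer.
    by move=> A B i' f _; exists \0 => a; rewrite [RHS]E0.
  - by [].
  - by apply/seteqP; split => // x _; exists x.
  - move=> i; apply/seteqP; split => // x _; exists 0 => //.
    by rewrite [RHS]E0.
  - by case.
have [E [i [Einj iinj]]] := enough_injectives M.
have [Q [pr [psurj pker]]] := quotient_projection (range_submodule i).
have hker x : pr x = 0 <-> exists a, i a = x.
  by rewrite pker; split=> [[a _ <-]|[a <-]]; exists a.
have hQ : ext_vanishes n Q.
  apply: (ext_vanishes_coker iinj psurj hker) => //.
    exact: noetherian_kernel.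
  exact/ext_vanishes_le/injective_ext_vanishes.
have [E' [eta [d [E'inj etainj ex0 ex E'0]]]] := IH _ hQ.
pose F k : rmodType R := if k is k'.+1 then E' k' else E.
pose d0 : {linear F 0%N -> F 1%N} := GRing.Linear.clone _ _ _ _ (eta \o pr) _.
pose dF k : {linear F k -> F k.+1} :=
  match k return {linear F k -> F k.+1} with 0 => d0 | k'.+1 => d k' end.
exists F, i, dF; split.
- by case.
- by [].
- apply/seteqP; split => x /=.
    by move=> [a _ <-]; rewrite (proj2 (hker _)) ?linear0 //; exists a.
  rewrite -(linear0 eta) => /etainj /hker[a <-]; by exists a.
- case=> [|k]; last exact: ex.
  rewrite -ex0; apply/seteqP; split => _ [x _ <-] /=; first by exists (pr x).
  by have [y <-] := psurj x; exists y.
- by case=> // k nk; apply: E'0.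
Qed.

(** * Terms and chosen solutions *)

(** Terms over the variables [X]. A node labelled 0 is a linear combination and
    a node labelled [q].+1 is one coordinate of the chosen solution of a system
    in [q] unknowns. Its first child is a leaf with the number of this coordinate
    and the rows of coefficients, and its other children are the right-hand sides.
    Trees which do not have this form take the value 0. General trees are
    used because they come with an encoding into lists, which bounds their
    number. *)
Definition term (S : pzRingType) (X : Type) := GenTree.tree (X + nat * seq (seq S)).

Section Terms.
Variables (S : pzRingType) (X : Type).
Notation term := (term S X).

Definition term_var (x : X) : term := GenTree.Leaf (inl x).
Definition term0 : term := GenTree.Node 0 [::].

Definition term_lin (s : S) (t u : term) : term :=
  GenTree.Node 0 [:: GenTree.Leaf (inr (0%N, [:: [:: s; 1]])); t; u].

Definition mx_rows p q (r : 'M[S]_(p, q)) : seq (seq S) :=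
  [seq [seq r i j | j <- enum 'I_q] | i <- enum 'I_p].

Definition term_solution p q (r : 'M[S]_(p, q)) (b : 'I_p -> term) (j : 'I_q) :
    term :=
  GenTree.Node q.+1
    (GenTree.Leaf (inr (nat_of_ord j, mx_rows r)) :: [seq b i | i <- enum 'I_p]).

Lemma nth_mx_rows p q (r : 'M[S]_(p, q)) (i : 'I_p) (j : 'I_q) :
  nth 0 (nth [::] (mx_rows r) i) j = r i j.
Proof.
rewrite (nth_map i) ?size_enum_ord // (nth_map j) ?size_enum_ord //.
by rewrite !nth_ord_enum.
Qed.

Variables (N Q : lmodType S) (pr : {linear N -> Q}) (v : X -> N).

(** Systems are solved modulo the kernel of [pr]. *)
Definition solves q (c : seq (seq S)) (b : seq N) (x : nat -> N) : Prop :=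
  forall i, (i < size b)%N -> pr (\sum_(j < q) (nth [::] c i)`_j *: x j) = pr b`_i.

Definition chosen_solution q c b : nat -> N :=
  if pselect (exists x, solves q c b x) is left h then sval (cid h) else fun=> 0.

Lemma chosen_solutionP q c b : (exists x, solves q c b x) ->
  solves q c b (chosen_solution q c b).
Proof. by rewrite /chosen_solution; case: pselect => // h _; case: cid. Qed.

Fixpoint eval (t : term) : N :=
  match t with
  | GenTree.Leaf (inl x) => v x
  | GenTree.Node n (GenTree.Leaf (inr (j, c)) :: ts) =>
      let b := map eval ts in
      if n is q.+1 then chosen_solution q c b j
      else \sum_(i < size b) (head [::] c)`_i *: b`_i
  | _ => 0
  end.

Lemma eval_lin s t u : eval (term_lin s t u) = s *: eval t + eval u.
Proof. by rewrite /= !big_ord_recl big_ord0 /= scale1r addr0. Qed.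

Lemma eval_submodule : is_submodule (range eval).
Proof.
split; first by exists term0.
by move=> s _ _ [t _ <-] [u _ <-]; exists (term_lin s t u); rewrite ?eval_lin.
Qed.

(** The values of the terms are closed under solvability of systems modulo
    the kernel of [pr]: their image in [Q] is pure. *)
Lemma eval_solution p q (r : 'M[S]_(p, q)) (b : 'I_p -> term) :
  solvable r (fun i => pr (eval (b i))) ->
    (forall z, exists x, pr x = z) ->
  forall i, pr (act r (fun j => eval (term_solution r b j)) i) = pr (eval (b i)).
Proof.
move=> [z hz] psurj i; have /choice[f hf] := psurj.
set bs := [seq eval t | t <- [seq b i | i <- enum 'I_p]].
have nbs (k : 'I_p) : bs`_k = eval (b k).
  by rewrite /bs -map_comp (nth_map k) ?size_enum_ord //= nth_ord_enum.
have szbs : size bs = p by rewrite 2!size_map size_enum_ord.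
pose y k := if insub k is Some j then f (z j) else 0.
have hy : solves q (mx_rows r) bs y.
  move=> k; rewrite szbs => kp; rewrite -[k]/(val (Ordinal kp)) nbs.
  rewrite -[RHS]/((fun i => pr (eval (b i))) (Ordinal kp)) -hz /act linear_sum.
  apply: eq_bigr => j _; rewrite linearZ nth_mx_rows.
  by rewrite /y valK hf.
have := @chosen_solutionP q (mx_rows r) bs (ex_intro _ y hy) i.
rewrite szbs ltn_ord nbs => /(_ isT) <-; congr (pr _).
by apply: eq_bigr => j _; rewrite nth_mx_rows.
Qed.
End Terms.

(** * The hull of a submodule under chosen solutions *)

(** The common shape of the conditions on RD-submodules and pure submodules,
    which ask it of all matrices of size 1 and of all matrices respectively. *)
Definition reflects_solvability (S : pzRingType) (N : lmodType S) (P : set N)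
    p q (r : 'M[S]_(p, q)) : Prop :=
  forall m : 'I_p -> N, (forall k, P (m k)) -> solvable r m ->
  exists x, (forall k, P (x k)) /\ act r x = m.

Section Hull.
Variables (S : pzRingType) (A N Q : lmodType S).
Variables (i : {linear A -> N}) (pr : {linear N -> Q}).
Hypotheses (iinj : injective i) (psurj : forall z, exists x, pr x = z).
Hypothesis (exact_mid : forall x, pr x = 0 <-> exists a, i a = x).
Variables (X : Type) (v : X -> N).
Local Notation ev := (eval pr v).

(** The sum of [A] and the values of the terms. *)
Definition hull : set N := [set x | exists a t, x = i a + ev t].

Lemma hull_submodule : is_submodule hull.
Proof.
split; first by exists 0, (term0 S X); rewrite linear0 addr0.
move=> s _ _ [a [t ->]] [b [u ->]]; exists (s *: a + b), (term_lin s t u).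
by rewrite eval_lin linearP scalerDr addrACA.
Qed.

(** A system with right-hand side in the hull which is solvable modulo [A] has a
    solution [y] modulo [A] among the values of terms. The difference is a system
    over [A], so the question reduces to solvability in [A]. *)
Lemma hull_solvable p q (r : 'M[S]_(p, q)) (m : 'I_p -> N) :
  (forall k, hull (m k)) -> solvable r (pr \o m) ->
  (forall (y : 'I_q -> N) a, (forall k, m k - act r y k = i (a k)) -> solvable r a) ->
  exists x, (forall k, hull (x k)) /\ act r x = m.
Proof.
move=> /choice[a /choice[t hm]] hr hA.
have prm k : pr (m k) = pr (ev (t k)).
  by rewrite hm linearD (proj2 (exact_mid _)) ?add0r //; exists (a k).
have {}hr : forall k, pr (act r (fun j => ev (term_solution r t j)) k) = pr (ev (t k)).
  apply: eval_solution => //; move: hr; congr solvable.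
  by apply/funext => k; apply: prm.
set y := fun j => ev (term_solution r t j) in hr.
have /choice[c hc] : forall k, exists c, m k - act r y k = i c.
  by move=> k; have /exact_mid[c <-] : pr (m k - act r y k) = 0;
    [rewrite linearB hr prm subrr|exists c].
have [z hz] := hA _ _ hc.
exists (fun j => i (z j) + y j); split=> [k|].
  by exists (z k), (term_solution r t k).
apply/funext => k; rewrite actD -[X in X + _]/(act r (i \o z) k) -act_linear hz -hc.
by rewrite subrK.
Qed.

Lemma hull_reflects p q (r : 'M[S]_(p, q)) :
  reflects_solvability (range i) r -> reflects_solvability hull r.
Proof.
move=> hA m hm [x hx]; apply: hull_solvable => // [|y a hy].
  by exists (pr \o x); apply/funext => k; rewrite -act_linear hx.
have [||z [hz rz]] := hA (i \o a); first by move=> k; exists (a k).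
  by exists (fun j => x j - y j); apply/funext => k; rewrite actB hx hy.
have /choice[c hc] : forall k, exists c, i c = z k.
  by move=> k; have [c _ <-] := hz k; exists c.
exists c; apply/funext => k; apply: iinj.
rewrite act_linear -[RHS]/((i \o a) k) -rz; congr (act r _ k).
by apply/funext => j; rewrite -hc.
Qed.

(** The hull is an extension of [A] by a pure submodule of [Q]. *)
Lemma hull_ext_vanishes n (P : lmodType S) (j : {linear P -> N}) :
  injective j -> range j = hull ->
  ext_vanishes n A -> ext_vanishes n Q -> ext_vanishes n P.
Proof.
move=> jinj hj hA hQ p q r m hr hm.
have [||y a hy|x [hx rx]] := @hull_solvable p q r (j \o m).
- by move=> k; rewrite -hj; exists (m k).
- by apply: hQ => //; do 2!apply: consistent_linear.
- apply: hA => //; apply: (consistent_inj iinj) => t u ur.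
  have -> : i \o a = fun k => (j \o m) k - act r y k by apply/funext => k; rewrite hy.
  apply/funext => k; rewrite actB -actM ur act0 subr0.
  by rewrite (consistent_linear j hm).
have /choice[z hz] : forall k, exists z, j z = x k.
  by move=> k; have := hx k; rewrite -hj => -[z _ <-]; exists z.
exists z; apply/funext => k; apply: jinj; rewrite act_linear.
rewrite -[RHS]/((j \o m) k) -rx; congr (act r _ k).
by apply/funext => l; rewrite -hz.
Qed.
End Hull.

Section Purity.
Variables (R : pzRingType) (N : rmodType R) (P : set N).

Lemma pure_submoduleE :
  pure_submodule P <-> forall p q (r : 'M[R^c]_(p, q)), reflects_solvability P r.
Proof.
split=> [hP p q r m hm [x hx]|hP p q r b hb [x hx]].
  have [|y [hy ey]] := hP p q r m hm; first by exists x => k; rewrite -hx.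
  by exists y; split=> //; apply/funext => k; rewrite -ey.
have actE (y : 'I_q -> N) k : act (\matrix_(i, j) r i j) y k = \sum_j r k j *: y j.
  by apply: eq_bigr => j _; rewrite mxE.
have [|y [hy ey]] := hP _ _ (\matrix_(i, j) r i j) b hb.
  by exists x; apply/funext => k; rewrite actE.
by exists y; split=> // k; rewrite -actE ey.
Qed.

Lemma RD_submoduleE : is_submodule P ->
  RD_submodule P <-> forall r : 'M[R^c]_1, reflects_solvability P r.
Proof.
move=> hsub; split=> [hP r m hm [x hx]|hP r].
  have e1 y : act r y 0 = r 0 0 *: y 0 by rewrite /act big_ord1.
  have : (P `&` range (fun m : N => r 0 0 *: m)) (m 0).
    by split=> //; exists (x 0); rewrite -?e1 ?hx.
  rewrite hP => -[y Py ey]; exists (fun=> y); split=> //.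
  by apply/funext => k; rewrite (ord1 k) e1.
apply/seteqP; split=> [z [Pz [y _ ry]]|_ [y Py <-]].
  rewrite -{}ry in Pz *; have [||x [hx ex]] := hP (const_mx r) (fun=> r *: y) => //.
    by exists (fun=> y); apply/funext => k; rewrite /act big_ord1 mxE.
  exists (x 0) => //.
  by have := congr1 (fun h => h 0) ex; rewrite /act big_ord1 mxE.
by split; [apply: submoduleZ|exists y].
Qed.
End Purity.

Section Classes.
Variables (R : pzRingType) (M : morphism_class R).
Hypothesis hM : M = @embeddings R \/ M = @RD_embeddings R \/ M = @pure_embeddings R.

Lemma pure_in_class (A B : rmodType R) (f : {linear A -> B}) :
  injective f -> pure_submodule (range f) -> M f.
Proof.
move=> finj /[dup] fpure /pure_submoduleE hf.
case: hM => [->|[->|->]]; [exact: finj| |by split]; split=> //.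
by apply/RD_submoduleE => [|r]; [exact: range_submodule|exact: hf].
Qed.

Lemma id_in_class (A : rmodType R) : M (idfun : {linear A -> A}).
Proof.
apply: pure_in_class => //; apply/pure_submoduleE => p q r m _ [x hx].
by exists x; split=> // k; exists (x k).
Qed.

(** The inclusion of the hull belongs to the same class as that of [A]. *)
Lemma hull_in_class (A N Q P : rmodType R) (i : {linear A -> N}) (pr : {linear N -> Q})
    X (v : X -> N) (f : {linear P -> N}) :
  injective i -> (forall z, exists x, pr x = z) ->
  (forall x, pr x = 0 <-> exists a, i a = x) ->
  injective f -> range f = hull i pr v -> M i -> M f.
Proof.
move=> iinj psurj ex finj hf.
have hr p q (r : 'M[R^c]_(p, q)) : reflects_solvability (range i) r ->
    reflects_solvability (range f) r.
  by move=> h; rewrite hf; apply: hull_reflects.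
case: hM => [->|[->|->]] // [_ hi]; split=> //.
  apply/RD_submoduleE => [|r]; first exact: range_submodule.
  by apply: hr; move: r; apply/RD_submoduleE => //; apply: range_submodule.
by apply/pure_submoduleE => p q r; apply: hr; move: p q r; apply/pure_submoduleE.
Qed.
End Classes.

(** * Cardinals *)

Definition embeds (A B : Type) : Prop := exists f : A -> B, injective f.

Lemma embeds_refl A : embeds A A.
Proof. by exists id. Qed.

Lemma embeds_trans B A C : embeds A B -> embeds B C -> embeds A C.
Proof. by move=> [f finj] [g ginj]; exists (g \o f); apply: inj_comp. Qed.

(** Injections are easier to compose than comparisons of full sets. *)
Lemma embeds_cardP A B : [set: A] #<= [set: B] <-> embeds A B.
Proof.
split=> [/card_leP[f]|[f finj]].
  exists (fun x => val (f (exist _ x (in_setT x)))) => x y /val_inj e.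
  by have /(congr1 val) := 'inj_f (in_setT _) (in_setT _) e.
have h : [set: A] #= range f.
  by rewrite card_eq_sym; apply: inj_card_eq => x y _ _; apply: finj.
by rewrite (card_le_eql h); apply: card_leT.
Qed.

(** Consider sets of functions in the product of the [F i] that are injective in
    every coordinate, and a maximal one [X]. Some coordinate [i] maps [X] onto
    [F i], since otherwise a function avoiding all values could be added; then
    [F i] is in bijection with [X] and embeds in each [F j]. *)
Lemma least_cardinality I T (F : I -> set T) : I ->
  exists i, forall j, exists h : T -> T,
    (forall x, F i x -> F j (h x)) /\ (forall x y, F i x -> F i y -> h x = h y -> x = y).
Proof.
move=> i0.
pose P (X : set (I -> T)) := (forall f i, X f -> F i (f i)) /\
  forall f g i, X f -> X g -> f i = g i -> f = g.
have [C CP Ctot|X [[XF Xinj] Xmax]] := @Zorn_bigcup _ P.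
  split=> [f i [Y CY Yf]|f g i [Y CY Yf] [Z CZ Zg]]; first exact: (proj1 (CP _ CY)).
  have [YZ|ZY] := Ctot _ _ CY CZ.
    by apply: (proj2 (CP _ CZ)) => //; apply: YZ.
  by apply: (proj2 (CP _ CY)) => //; apply: ZY.
have [i hi] : exists i, forall x, exists f, F i x -> X f /\ f i = x.
  apply: contrapT => /forallNP h.
  have /choice[f hf] : forall i, exists x, F i x /\ forall f, X f -> f i <> x.
    move=> i; have /existsNP[x hx] := h i; exists x.
    move/forallNP: hx => hx; split.
      by apply: contrapT => nFx; apply: (hx (fun=> x)).
    by move=> f Xf fx; apply: (hx f).
  have nXf : ~ X f by move=> Xf; apply: (proj2 (hf i0) f Xf).
  apply: (Xmax (X `|` [set f])).
    by split=> [g ?|/(_ f)]; [left|move=> h'; apply/nXf/h'; right].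
  split=> [g j [Xg|->]|g g' j [Xg|->] [Xg'|->]] //; first exact: XF.
  - by case: (hf j).
  - exact: Xinj.
  - by move=> e; case: (proj2 (hf j) g Xg).
  - by move=> e; case: (proj2 (hf j) g' Xg').
have /choice[s hs] := hi.
exists i => j; exists (fun x => s x j); split=> [x /hs[Xs _]|x y /hs[Xx ex] /hs[Xy ey] e].
  exact: XF.
by rewrite -ex -ey (Xinj _ _ j Xx Xy e).
Qed.

Lemma embeds_total A B : embeds A B \/ embeds B A.
Proof.
have [b hb] := @least_cardinality bool (A + B)
  (fun b => if b then range inl else range inr) true.
have [h [hF hinj]] := hb (~~ b); case: b {hb} hF hinj => /= hF hinj; [left|right].
  have /choice[f hf] : forall a : A, exists b : B, h (inl a) = inr b.
    by move=> a; have [|b _ <-] := hF (inl a); [exists a|exists b].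
  exists f => x y e; suff [] : inl x = inl y :> A + B by [].
  by apply: hinj; [exists x|exists y|rewrite !hf e].
have /choice[f hf] : forall a : B, exists b : A, h (inr a) = inl b.
  by move=> a; have [|b _ <-] := hF (inr a); [exists a|exists b].
exists f => x y e; suff [] : inr x = inr y :> A + B by [].
by apply: hinj; [exists x|exists y|rewrite !hf e].
Qed.

Section Square.
Variable T : Type.

Let dom (G : set (T * T * T)) : set T := [set x | exists z, G (x, x, z)].

(** [G] is the graph of an injection from [D * D] to [D], where [D] is the
    subset [dom G] of [T]. *)
Definition is_pairing (G : set (T * T * T)) : Prop :=
  [/\ forall x y, dom G x -> dom G y -> exists z, G (x, y, z),
      forall x y z, G (x, y, z) -> [/\ dom G x, dom G y & dom G z],
      forall x y z z', G (x, y, z) -> G (x, y, z') -> z = z' &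
      forall x y x' y' z, G (x, y, z) -> G (x', y', z) -> x = x' /\ y = y'].

(** Let [g] be a maximal injection from [D * D] to [D] extending one on a
    countable set. If [D] embeds in its complement by [k], then [D] and [k D]
    together are two copies of [D], and the pairs which are not in [D * D] embed
    in [k D], so [g] is not maximal. Hence the complement of [D] embeds in
    [D], and [T] embeds in [D * D] and then in [D]. *)
Lemma embeds_square : embeds nat T -> embeds (T * T) T.
Proof.
move=> [e einj].
pose G0 : set (T * T * T) := [set p | exists m n, p = (e m, e n, e (pickle (m, n)))].
have domG0 x : dom G0 x <-> exists n, x = e n.
  split=> [[z [m [n [-> _ _]]]]|[n ->]]; first by exists m.
  by exists (e (pickle (n, n))), n, n.
have [|C CP [G1 CG1] Ctot|G [[Gtot Gdom Gfun Ginj] G0G Gmax]] :=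
    @Zorn_above _ is_pairing G0.
- split=> [x y /domG0[m ->] /domG0[n ->]|x y z [m [n [-> -> ->]]]|
           x y z z' [m [n [-> -> ->]]] [m' [n' [/einj <- /einj <- ->]]] //|
           x y x' y' z [m [n [-> -> ->]]] [m' [n' [-> -> /einj]]]].
  + by exists (e (pickle (m, n))), m, n.
  + by split; apply/domG0; [exists m|exists n|exists (pickle (m, n))].
  + by move=> /(pcan_inj pickleK) [-> ->].
- have dsub (H : set (T * T * T)) : C H -> dom H `<=` dom (\bigcup_(X in C) X).
    by move=> CH x [z Hz]; exists z, H.
  have common H H' : C H -> C H' -> exists K, [/\ C K, H `<=` K & H' `<=` K].
    by move=> CH CH'; have [HH'|HH'] := Ctot _ _ CH CH'; [exists H'|exists H]; split.
  split=> [x y [z [H CH Hz]] [z' [H' CH' Hz']]|x y z [H CH Hz]|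
           x y z z' [H CH Hz] [H' CH' Hz']|x y x' y' z [H CH Hz] [H' CH' Hz']].
  + have [K [CK HK H'K]] := common _ _ CH CH'; have [Ktot _ _ _] := CP _ CK.
    have [||w Kw] := Ktot x y; first by exists z; apply: HK.
      by exists z'; apply: H'K.
    by exists w; exists K.
  + have [_ Hdom _ _] := CP _ CH; have [? ? ?] := Hdom _ _ _ Hz.
    by split; apply: dsub CH _ _.
  + have [K [CK HK H'K]] := common _ _ CH CH'; have [_ _ Kfun _] := CP _ CK.
    by apply: Kfun; [apply: HK Hz|apply: H'K Hz'].
  + have [K [CK HK H'K]] := common _ _ CH CH'; have [_ _ _ Kinj] := CP _ CK.
    by apply: Kinj; [apply: HK Hz|apply: H'K Hz'].
have De n : dom G (e n) by exists (e (pickle (n, n))); apply: G0G; exists n, n.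
have /choice[g hg] : forall p : T * T, exists z,
    dom G p.1 -> dom G p.2 -> G (p.1, p.2, z).
  move=> [x y] /=; have [[Dx Dy]|h] := pselect (dom G x /\ dom G y).
    by have [z Gz] := Gtot _ _ Dx Dy; exists z.
  by exists x => Dx Dy; case: h.
have gD x y : dom G x -> dom G y -> dom G (g (x, y)).
  by move=> Dx Dy; have [] := Gdom _ _ _ (hg (x, y) Dx Dy).
have ginj x y x' y' : dom G x -> dom G y -> dom G x' -> dom G y' ->
    g (x, y) = g (x', y') -> x = x' /\ y = y'.
  move=> Dx Dy Dx' Dy' E; apply: (Ginj _ _ _ _ (g (x, y))); first exact: (hg (x, y)).
  by rewrite E; apply: (hg (x', y')).
have [|[k kinj]] := embeds_total {x | ~ dom G x} {x | dom G x}; last first.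
  exfalso.
  pose u b (x : T) : T :=
    if b then (if pselect (dom G x) is left h then sval (k (exist _ x h)) else x)
    else x.
  have uD x : dom G x -> ~ dom G (u true x).
    by rewrite /u; case: pselect => // h _; case: (k _).
  have uinj b c x y : dom G x -> dom G y -> u b x = u c y -> b = c /\ x = y.
    move=> Dx Dy; case: b c => [] [] E.
    - split=> //; move: E; rewrite /u; case: pselect => // hx; case: pselect => // hy.
      by move=> /eq_sig_hprop-/(_ (fun=> @Prop_irrelevance _)) /kinj /(congr1 sval).
    - by case: (uD x Dx); rewrite E.
    - by case: (uD y Dy); rewrite -E.
    - by [].
  (* [u b] is the embedding of the copy [b] of the domain. The element
     [e (b + 2 c)] of the domain records from which copies a pair comes, so that
     [code] sends distinct pairs to distinct elements of the copy [true]. *)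
  pose code (b c : bool) x y := u true (g (g (x, y), e (b + c.*2)%N)).
  pose G' : set (T * T * T) := [set p | G p \/ exists b c x y,
    [/\ b || c, dom G x, dom G y & p = (u b x, u c y, code b c x y)]].
  have domG' z : dom G' z <-> exists b x, dom G x /\ z = u b x.
    split=> [[w [Gz|[b [c [x [y [_ Dx _ [-> _ _]]]]]]]]|[[] [x [Dx ->]]]].
    - by exists false, z; split=> //; exists w.
    - by exists b, x.
    - by exists (code true true x x); right; exists true, true, x, x.
    - by have [w Gw] := Dx; exists w; left.
  have Dg x y n : dom G x -> dom G y -> dom G (g (g (x, y), e n)).
    by move=> Dx Dy; exact: gD _ _ (gD _ _ Dx Dy) (De n).
  have codeinj b c x y b' c' x' y' : dom G x -> dom G y -> dom G x' -> dom G y' ->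
      code b c x y = code b' c' x' y' -> u b x = u b' x' /\ u c y = u c' y'.
    move=> Dx Dy Dx' Dy' /uinj[||_]; [exact: Dg|exact: Dg|].
    move=> /ginj[|||| E /einj]; do ?[exact: De|exact: gD].
    have [//|//|//|//|-> ->] := ginj _ _ _ _ _ _ _ _ E.
    by case: b b' c c' => [] [] [] [].
  have [z Gz] : exists z, G (u true (e 0), u true (e 0), z).
    exists (code true true (e 0) (e 0)); apply: (Gmax G'); last first.
    - by right; exists true, true, (e 0), (e 0).
    - by move=> p Gp; left.
    split.
    - move=> _ _ /domG'[b [x [Dx ->]]] /domG'[c [y [Dy ->]]].
      have [bc|] := boolP (b || c).
        by exists (code b c x y); right; exists b, c, x, y.
      rewrite negb_or => /andP[/negPf -> /negPf ->].
      by have [w Gw] := Gtot _ _ Dx Dy; exists w; left.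
    - move=> x y z [/Gdom[[x' Gx] [y' Gy] [z' Gz]]|].
        by split; [exists x'|exists y'|exists z']; left.
      move=> [b [c [x' [y' [bc Dx Dy [-> -> ->]]]]]].
      split; apply/domG'; [by exists b, x'|by exists c, y'|].
      by exists true, (g (g (x', y'), e (b + c.*2)%N)); split=> //; apply: Dg.
    - move=> x y z z' [Gz|[b [c [x1 [y1 [bc Dx Dy [ex ey ->]]]]]]]
        [Gz'|[b' [c' [x2 [y2 [bc' Dx' Dy' [ex' ey' ->]]]]]]].
      + exact: Gfun Gz Gz'.
      + have [Gx Gy _] := Gdom _ _ _ Gz.
        case: b' bc' ex' => bc' ex'; first by case: (uD _ Dx'); rewrite -ex'.
        by case: c' bc' ey' => // _ ey'; case: (uD _ Dy'); rewrite -ey'.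
      + have [Gx Gy _] := Gdom _ _ _ Gz'.
        case: b bc ex => bc ex; first by case: (uD _ Dx); rewrite -ex.
        by case: c bc ey => // _ ey; case: (uD _ Dy); rewrite -ey.
      + by move: ex' ey'; rewrite ex ey => /uinj[//|//|-> ->] /uinj[//|//|-> ->].
    - move=> x y x' y' z [Gz|[b [c [x1 [y1 [bc Dx Dy [-> -> ez]]]]]]]
        [Gz'|[b' [c' [x2 [y2 [bc' Dx' Dy' [-> -> ez']]]]]]].
      + exact: Ginj Gz Gz'.
      + have [_ _ Gz1] := Gdom _ _ _ Gz.
        by case: (uD (g (g (x2, y2), e (b' + c'.*2)%N))); [exact: Dg|rewrite -[u _ _]ez'].
      + have [_ _ Gz1] := Gdom _ _ _ Gz'.
        by case: (uD (g (g (x1, y1), e (b + c.*2)%N))); [exact: Dg|rewrite -[u _ _]ez].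
      + by apply: codeinj => //; rewrite -/(code _ _ _ _) -ez -ez'.
  by have [Du _ _] := Gdom _ _ _ Gz; apply: (uD (e 0)).
move=> [k kinj].
(* [e 0] and [e 1] mark the elements outside and inside the domain *)
pose w x : T := if pselect (dom G x) is right h
  then g (e 0, sval (k (exist _ x h))) else g (e 1, x).
have wD x : dom G (w x).
  rewrite /w; case: pselect => h; apply: gD => //.
  exact: (svalP (k (exist _ x h))).
have winj : injective w.
  move=> x y; rewrite /w; case: pselect => hx; case: pselect => hy.
  - by move=> /ginj[]//.
  - move=> /ginj[]//; first exact: (svalP (k (exist _ y hy))).
    by move=> /einj.
  - move=> /ginj[]//; first exact: (svalP (k (exist _ x hx))).
    by move=> /einj.
  - move=> /ginj[]//.
    + exact: (svalP (k (exist _ x hx))).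
    + exact: (svalP (k (exist _ y hy))).
    by move=> _ /eq_sig_hprop-/(_ (fun=> @Prop_irrelevance _)) /kinj /(congr1 sval).
exists (fun p => g (w p.1, w p.2)) => -[x y] [x' y'] /= /ginj[]// /winj -> /winj -> //.
Qed.
End Square.

(** * Cardinal arithmetic *)

Section InfiniteArithmetic.
Variables (T : Type) (hT : embeds nat T).

Lemma embeds_prod A B : embeds A T -> embeds B T -> embeds (A * B) T.
Proof.
move=> [f finj] [g ginj]; apply: embeds_trans (embeds_square hT).
by exists (fun p => (f p.1, g p.2)) => -[a b] [c d] /= [/finj -> /ginj ->].
Qed.

Lemma embeds_sum A B : embeds A T -> embeds B T -> embeds (A + B) T.
Proof.
move=> [f finj] [g ginj]; apply: embeds_trans (embeds_prod hT (embeds_refl T)).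
exists (fun s => match s with inl a => (0%N, f a) | inr b => (1%N, g b) end).
by move=> [a|b] [a'|b'] //= [] => [/finj|/ginj] ->.
Qed.

Lemma embeds_seq A : embeds A T -> embeds (seq A) T.
Proof.
move=> [f finj]; have [h hinj] := embeds_square hT.
have [e _] := hT.
pose code s := foldr (fun a x => h (f a, x)) (e 0%N) s.
apply: embeds_trans (embeds_prod hT (embeds_refl T)).
exists (fun s => (size s, code s)) => s t [].
elim: s t => [|a s IH] [|b t] //= [st] /hinj[/finj -> E].
by congr cons; apply: IH.
Qed.

Lemma embeds_tree A : embeds A T -> embeds (GenTree.tree A) T.
Proof.
move=> hA; apply: embeds_trans (embeds_seq (embeds_sum hT hA)).
exists (@GenTree.encode A); exact: pcan_inj (@GenTree.codeK A).
Qed.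

Lemma embeds_term (S : pzRingType) X :
  embeds S T -> embeds X T -> embeds (term S X) T.
Proof.
move=> hS hX; apply/embeds_tree/embeds_sum => //.
by apply: embeds_prod => //; do 2!apply: embeds_seq.
Qed.
End InfiniteArithmetic.

(** Consing embeds products [X * seq X] in [seq X], which is why 2^|seq X| absorbs
    a point and, in the next lemma, powers with exponent [X]. *)
Lemma embeds_option_pow X : X -> embeds (option (seq X -> bool)) (seq X -> bool).
Proof.
move=> x0.
exists (fun o s => if o is Some f then (if s is _ :: s' then f s' else false) else true).
move=> [f|] [g|] // E; last 2 first.
- by have := congr1 (fun h => h [::]) E.
- by have := congr1 (fun h => h [::]) E.
by congr Some; apply/funext => s; have := congr1 (fun h => h (x0 :: s)) E.
Qed.

Lemma embeds_fun_pow X W : embeds W X -> embeds (W -> seq X -> bool) (seq X -> bool).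
Proof.
move=> [w winj].
have /choice[d hd] : forall x, exists o : option W, forall a, w a = x -> o = Some a.
  move=> x; have [[a <-]|h] := pselect (exists a, w a = x).
    by exists (Some a) => b /winj ->.
  by exists None => a ax; case: h; exists a.
exists (fun g s =>
  if s is x :: s' then (if d x is Some a then g a s' else false) else false).
move=> f g E; apply/funext => a; apply/funext => s.
by have := congr1 (fun h => h (w a :: s)) E; rewrite /= (hd _ a erefl).
Qed.

Lemma embeds_fun W A B : embeds A B -> embeds (W -> A) (W -> B).
Proof.
move=> [f finj]; exists (fun g => f \o g) => g g' E; apply/funext => w.
by apply: finj; exact: (congr1 (fun h => h w) E).
Qed.

(** * The Loewenheim-Skolem number and stability *)

Section LowenheimSkolem.
Variables (R : pzRingType) (C : module_class R) (M : morphism_class R).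

Lemma LS_bound_mono (K L : cardinal) : LS_bound C M K -> embeds K L -> LS_bound C M L.
Proof.
move=> [Kinf RK hK] KL; split.
- apply/infiniteP; apply: card_le_trans (proj1 (infiniteP _) Kinf) _.
  exact/embeds_cardP.
- by apply: card_le_trans RK _; apply/embeds_cardP.
move=> A B i CB iinj; have [A' [j [ej ij A'K]]] := hK A B i CB iinj.
exists A', j; split=> //; apply: card_le_trans A'K _; apply/embeds_cardP.
have [f finj] := KL.
exists (fun s => match s with inl a => inl a | inr b => inr (f b) end).
by move=> [a|b] [a'|b'] //= [] => [->|/finj ->].
Qed.

(** It is enough to look for the least bound among the subsets of one bound. *)
Lemma LS_exists (K : cardinal) : LS_bound C M K -> exists L, is_LS C M L.
Proof.
move=> hK.
pose F (X : {X : K -> Prop | LS_bound C M {x | X x}}) : set K := sval X.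
have sub_le (X Y : K -> Prop) (h : K -> K) : (forall x, X x -> Y (h x)) ->
    (forall x y, X x -> X y -> h x = h y -> x = y) -> embeds {x | X x} {x | Y x}.
  move=> hXY hinj; exists (fun x => exist _ (h (sval x)) (hXY _ (svalP x))).
  move=> [x Xx] [y Xy] /(congr1 sval) /= /hinj e; apply: eq_exist; exact: e.
have hT : LS_bound C M {x : K | True}.
  by apply: LS_bound_mono hK _; exists (fun x => exist _ x I) => x y /(congr1 sval).
have [[S hS] hmin] := @least_cardinality _ _ F (exist _ (fun=> True) hT).
have minS (X : K -> Prop) : LS_bound C M {x | X x} -> embeds {x | S x} {x | X x}.
  by move=> hX; have [h [h1 h2]] := hmin (exist _ X hX); apply: sub_le h1 h2.
exists {x | S x}; split=> // L hL; apply/embeds_cardP.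
have [KL|[f finj]] := embeds_total K L.
  by apply: embeds_trans KL; exists sval => -[x Sx] [y Sy] /= e; apply: eq_exist.
have /minS h : LS_bound C M {x | range f x}.
  apply: LS_bound_mono hL _.
  by exists (fun l => exist _ (f l) (imageT f l)) => x y /(congr1 sval) /finj.
apply: (embeds_trans h).
have /choice[g hg] : forall y : {x | range f x}, exists l, f l = sval y.
  by move=> y; have [l _ fl] := svalP y; exists l.
exists g => x y e; have : sval x = sval y by rewrite -!hg e.
by case: x y {e} => [x fx] [y fy] /= e; apply: eq_exist.
Qed.
End LowenheimSkolem.

Section Stability.
Variables (R : pzRingType) (hR : right_noetherian R) (n : nat) (M : morphism_class R).
Hypothesis hM : M = @embeddings R \/ M = @RD_embeddings R \/ M = @pure_embeddings R.
Notation C := (@injdim_le R n).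

Let noeth : noetherian R^c := right_noetherian_converse hR.

Lemma injdimP (A : rmodType R) : C A <-> ext_vanishes n A.
Proof. by split; [apply: injdim_ext_vanishes|apply: ext_vanishes_injdim]. Qed.

(** The closure of the image of [A] under chosen solutions of systems in [B] is
    pure, hence in I_n, and consists of values of terms with variables in [A]. *)
Lemma LS_bound_injdim : LS_bound C M (nat + R)%type.
Proof.
have natT (A : Type) : embeds nat (A + (nat + R)).
  by exists (fun k => inr (inl k)) => x y [].
split.
- by apply/infiniteP/embeds_cardP; exists inl => x y [].
- by apply/embeds_cardP; exists inr => x y [].
move=> A B i CB iinj.
have [A' [j [jinj hj]]] :=
  submodule_inclusion (eval_submodule (idfun : {linear B -> B}) i).
have pureA' p q (r : 'M[R^c]_(p, q)) : reflects_solvability (range j) r.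
  rewrite hj => m Pm [x hx].
  have /choice[t ht] : forall k, exists t, eval idfun i t = m k.
    by move=> k; have [t _ et] := Pm k; exists t.
  exists (fun k => eval idfun i (term_solution r t k)); split=> [k|].
    by exists (term_solution r t k).
  apply/funext => k; rewrite -ht.
  apply: (@eval_solution _ _ _ _ (idfun : {linear B -> B}) i) => [|z]; last by exists z.
  by exists x; rewrite hx; apply/funext => l; rewrite -ht.
have CA' : C A'.
  apply/injdimP/(ext_vanishes_sub jinj) => [p q r m [x hx]|]; last exact/injdimP.
  have [||y [hy ry]] := pureA' p q r (j \o m); first by move=> k; exists (m k).
    by exists x.
  have /choice[z hz] : forall k, exists z, j z = y k.
    by move=> k; have [z _ <-] := hy k; exists z.
  exists z; apply/funext => k; apply: jinj; rewrite act_linear -[RHS]/((j \o m) k) -ry.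
  by congr (act r _ k); apply/funext => l; apply: hz.
exists A', j; split.
- split=> //; apply: pure_in_class => //; apply/pure_submoduleE => p q r.
  exact: pureA'.
- by rewrite hj => _ [a _ <-]; exists (term_var R^c a).
apply/embeds_cardP.
have hterm : embeds (term R^c A) (A + (nat + R)).
  apply: embeds_term => //; last by exists inl => x y [].
  by exists (fun r => inr (inr r)) => x y [].
apply: embeds_trans hterm.
have /choice[t ht] : forall a : A', exists t, eval idfun i t = j a.
  by move=> a; have : range j (j a) by [exists a]; rewrite hj => -[t _ <-]; exists t.
by exists t => a b e; apply: jinj; rewrite -!ht e.
Qed.

Section Types.
Variable A : rmodType R.
Notation triple := (triple C unit A).
Notation W := (term R^c unit).

(** [phi] records which terms over the tuple of [t] have their value in [A], and
    which value it is. *)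
Definition type_code (t : triple) (phi : W -> option A) : Prop :=
  exists (Q : rmodType R) (pr : {linear tr_mod t -> Q}),
  [/\ forall z, exists x, pr x = z,
      forall x, pr x = 0 <-> exists a, tr_incl t a = x &
      forall w a, phi w = Some a <-> eval pr (tr_tuple t) w = tr_incl t a].

Lemma type_code_exists (t : triple) : exists phi, type_code t phi.
Proof.
have [Q [pr [psurj pker]]] := quotient_projection (range_submodule (tr_incl t)).
have hcode w : exists o : option A, forall a,
    o = Some a <-> eval pr (tr_tuple t) w = tr_incl t a.
  have [[a ea]|h] := pselect (exists a, eval pr (tr_tuple t) w = tr_incl t a).
    exists (Some a) => b; split=> [[<-] //|]; rewrite ea => /(@tr_inclP _ _ _ _ t).
    by move=> ->.
  by exists None => a; split=> // e; case: h; exists a.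
have /choice[phi hphi] := hcode.
exists phi, Q, pr; split=> // x; rewrite pker.
by split=> [[a _ <-]|[a <-]]; exists a.
Qed.

Lemma atomically_related_sym (t t' : triple) :
  atomically_related M t t' -> atomically_related M t' t.
Proof. by move=> [N [f [g [hf hg hA ht]]]]; exists N, g, f; split. Qed.

(** Two steps suffice below, since one triple on the hull is related to both
    sides. *)
Lemma gtp_common (t s t' : triple) :
  atomically_related M t s -> atomically_related M s t' -> gtp M t = gtp M t'.
Proof.
move=> ts st'; apply/funext => x; apply/propext; split=> h.
  apply: Relation_Operators.t_trans h; apply: (Relation_Operators.t_trans _ _ _ s);
    by apply/Relation_Operators.t_step/atomically_related_sym.
by apply: Relation_Operators.t_trans h; apply: (Relation_Operators.t_trans _ _ _ s);
    apply/Relation_Operators.t_step.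
Qed.

(** With [s] the triple carried by the hull of [A] in [tr_mod t]: it embeds in
    [tr_mod t] by inclusion, and in [tr_mod t'] by [i a + eval w |-> i' a + eval w],
    which is well defined and injective because the codes agree. *)
Lemma type_code_gtp (t t' : triple) phi :
  A_embedding C M (tr_incl t) -> A_embedding C M (tr_incl t') ->
  type_code t phi -> type_code t' phi -> gtp M t = gtp M t'.
Proof.
move=> [CA CN iinj Mi] [_ CN' i'inj Mi'].
move=> [Q [pr [psurj ex hphi]]] [Q' [pr' [psurj' ex' hphi']]].
set i := tr_incl t in iinj Mi ex hphi; set b := tr_tuple t in hphi.
set i' := tr_incl t' in i'inj Mi' ex' hphi'; set b' := tr_tuple t' in hphi'.
have [P [j [jinj hj]]] := submodule_inclusion (hull_submodule i pr b).
have CP : C P.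
  apply/injdimP/(hull_ext_vanishes iinj psurj ex jinj hj); first exact/injdimP.
  apply: (ext_vanishes_coker iinj psurj ex) (noetherian_kernel noeth) _ _.
    exact/ext_vanishesW/injdimP.
  exact/injdimP.
have Mj : M j by apply: (hull_in_class hM iinj psurj ex jinj hj).
(* Both equations say that the term [w - w'] has the value [a' - a]. *)
have transfer w w' a a' : i a + eval pr b w = i a' + eval pr b w' <->
    i' a + eval pr' b' w = i' a' + eval pr' b' w'.
  have E (N Q0 : rmodType R) (k : {linear A -> N}) (p : {linear N -> Q0})
      (c : unit -> N) :
      k a + eval p c w = k a' + eval p c w' <->
      eval p c (term_lin (-1) w' w) = k (a' - a).
    rewrite eval_lin linearB scaleN1r; split=> [h|h].
      have -> : eval p c w = k a' + eval p c w' - k a by rewrite -h addrAC subrr add0r.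
      by rewrite addrC addrAC addrK.
    have -> : eval p c w = k a' - k a + eval p c w' by rewrite -h addrAC addNr add0r.
    by rewrite addrA [k a + _]addrC subrK.
  by rewrite E -hphi hphi' -E.
have hP x : exists a w, j x = i a + eval pr b w.
  by have : range j (j x) by [exists x]; rewrite hj.
have [x|x y y' [a [w [ew ->]]] [a' [w' [ew' ->]]]|
      s x y x' y' [a [w [ew ->]]] [a' [w' [ew' ->]]]|f hf] :=
  @linear_of_graph R^c P (tr_mod t') (fun x y => exists a w,
     j x = i a + eval pr b w /\ y = i' a + eval pr' b' w).
- by have [a [w h]] := hP x; exists (i' a + eval pr' b' w), a, w.
- by apply/transfer; rewrite -ew -ew'.
- exists (s *: a + a'), (term_lin s w w').
  by rewrite !eval_lin !linearP ew ew' !scalerDr; split; rewrite addrACA.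
have finj : injective f.
  move=> x y; have [a [w [ex1 ->]]] := hf x; have [a' [w' [ey ->]]] := hf y.
  by move/transfer; rewrite -ex1 -ey => /jinj.
have frange : range f = hull i' pr' b'.
  apply/seteqP; split=> [_ [x _ <-]|_ [a [w ->]]].
    by have [a [w [_ ->]]] := hf x; exists a, w.
  have [x _ jx] : range j (i a + eval pr b w) by rewrite hj; exists a, w.
  exists x => //; have [a' [w' [e ->]]] := hf x.
  by apply/transfer; rewrite -e.
have Mf : M f by apply: (hull_in_class hM i'inj psurj' ex' finj frange).
have [k hk] : exists k : {linear A -> P}, forall a, j (k a) = i a.
  apply: (@linear_of_graph _ A P (fun a x => j x = i a))
    => [a|a x y <- /jinj //|s a x a' x' e e'].
    have [x _ jx] : range j (i a).
      by rewrite hj; exists a, (term0 _ _); rewrite addr0.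
    by exists x.
  by rewrite !linearP e e'.
have kinj : injective k by move=> a a' e; apply: iinj; rewrite -!hk e.
have [c hc] : exists c, j c = b tt.
  have [c _ jc] : range j (b tt).
    by rewrite hj; exists 0, (term_var _ tt); rewrite linear0 add0r.
  by exists c.
pose s := Triple CP kinj (fun _ : unit => c).
apply: (@gtp_common t s t').
  exists (tr_mod t), idfun, j; split.
  - by split=> //; apply: id_in_class.
  - by split.
  - by move=> a; apply/esym/hk.
  - by case; apply/esym/hc.
exists (tr_mod t'), f, idfun; split.
- by split.
- by split=> //; apply: id_in_class.
- move=> a; have [a' [w' [e ->]]] := hf (k a).
  have := transfer (term0 _ _) w' a a'; rewrite /= !addr0 -e hk => -[h _].
  by rewrite -h.
- case; have [a [w [e ->]]] := hf c.
  have := transfer (term_var _ tt) w 0 a; rewrite /= !linear0 !add0r -e hc => -[h _].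
  by rewrite -h.
Qed.

End Types.

(** Galois types over [A] inject into their codes, whose number is
    |A + 1|^|terms| and hence at most |A| = 2^|seq X|. *)
Lemma stable_in_pow (X : Type) : embeds (term R^c unit) X ->
  stable_in C M (seq X -> bool).
Proof.
move=> WX A CA AL.
have [code codeinj] : embeds (term R^c unit -> option A) (seq X -> bool).
  have [x0 _] := WX.
  have AX : embeds A (seq X -> bool).
    by apply/embeds_cardP; move: AL; rewrite card_eq_le => /andP[].
  apply: embeds_trans (embeds_fun_pow WX); apply: embeds_fun.
  apply: embeds_trans (embeds_option_pow (x0 (term0 _ _))).
  have [h hinj] := AX; exists (omap h) => -[a|] [b|] //= [/hinj ->] //.
pose codes (p : triple C unit A -> Prop) phi := exists t : triple C unit A,
  [/\ A_embedding C M (tr_incl t), p = gtp M t & type_code t phi].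
exists (fun p => if pselect (exists phi, codes p phi) is left h
                 then code (sval (cid h)) else fun=> false).
have gSP p : gS M p -> exists phi, codes p phi.
  move=> [t [ht ->]]; have [phi hphi] := type_code_exists t.
  by exists phi, t.
move=> p q /gSP hp /gSP hq.
case: pselect => // hp'; case: pselect => // hq' /codeinj.
case: (cid hp') (cid hq') => phi + [psi +] /= E; rewrite -{}E.
move=> [t [ht -> tphi]] [u [hu -> upsi]].
by apply: (type_code_gtp ht hu tphi).
Qed.
End Stability.

Theorem corollary3p21 (R : pzRingType) (hR : right_noetherian R) (n : nat)
    (M : morphism_class R)
    (hM : M = @embeddings R \/ M = @RD_embeddings R \/ M = @pure_embeddings R) :
  stable (@injdim_le R n) M.
Proof.
have [K hK] := LS_exists (LS_bound_injdim hR n hM).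
exists K; split=> //.
exists (seq (term R^c unit + K) -> bool); split.
  apply/embeds_cardP; exists (fun k s => `[< s = [:: inr k] >]) => k l E.
  have /asboolP : `[< [:: inr k] = [:: inr l] :> seq (term R^c unit + K) >].
    by rewrite -(congr1 (fun h => h [:: inr k]) E); apply/asboolP.
  by case.
by apply: stable_in_pow => //; exists inl => x y [].
Qed.
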